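(* Let $K$ be a finite subset of the closed unit disc in $\mathbb{C}$. Suppose that $x\in K^{\mathbb{N}}$ is generic for a shift-invariant Borel probability measure $\mu$ on $K^{\mathbb{N}}$. The following conditions are equivalent: (1) $x$ is weakly correlated to some point $y\in K^{\mathbb{N}}$ which is generic for an ergodic measure on $K^{\mathbb{N}}$; (2) $x$ is strongly correlated to some point $y\in K^{\mathbb{N}}$ which is generic for an ergodic measure on $K^{\mathbb{N}}$; (3) $\mu$ is correlated to some ergodic measure on $K^{\mathbb{N}}$.
   Context: $\mathbb{N}=\{1,2,\dots\}$; $K^{\mathbb{N}}$ carries the left shift, and ''ergodic measure'' means an ergodic shift-invariant Borel probability measure. A point $x\in K^{\mathbb{N}}$ is generic for a shift-invariant probability measure $\mu$ if for every $m\ge1$ and every block $B\in K^m$, $\lim_n\frac1n\#\{i\in\{1,\dots,n\}:[x_i,\dots,x_{i+m-1}]=B\}=\mu(B)$, where $\mu(B)$ is the measure of the cylinder determined by $B$ at coordinates $1,\dots,m$. Correlation of sequences: for blocks $A=[a_1,\dots,a_n]$, $B=[b_1,\dots,b_n]$ of complex numbers put $\mathsf{corr}(A,B)=\frac1n\sum_{i=1}^n a_i\overline{b_i}-\bigl(\frac1n\sum_{i=1}^n a_i\bigr)\bigl(\frac1n\sum_{i=1}^n\overline{b_i}\bigr)$. Let $x_{[1,n]}=[x_1,\dots,x_n]$. Two bounded sequences $x,y$ are weakly correlated if $\limsup_n|\mathsf{corr}(x_{[1,n]},y_{[1,n]})|>0$, and strongly correlated if $\liminf_n|\mathsf{corr}(x_{[1,n]},y_{[1,n]})|>0$.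 Correlation of measures: for shift-invariant probability measures $\mu,\nu$ on $K^{\mathbb{N}}$, $\mathsf{corr}(\mu,\nu)=\sup_\xi\left|\int x_1\overline{y_1}\,d\xi-\int x_1\,d\mu\cdot\int\overline{y_1}\,d\nu\right|$, where $\xi$ ranges over all joinings of $\mu$ and $\nu$ (shift-invariant probability measures on $K^{\mathbb{N}}\times K^{\mathbb{N}}$ with marginals $\mu$ and $\nu$) and $x_1,y_1$ denote the first-symbol functions of $x$ and $y$. The measures are correlated if $\mathsf{corr}(\mu,\nu)\neq0$. *)

(* Defs.v *)
From HB Require Import structures.
From mathcomp Require Import all_boot all_order all_algebra finmap.
From mathcomp Require Import complex.
From mathcomp Require Import all_classical all_reals all_analysis.

Set Implicit Arguments.
Unset Strict Implicit.
Unset Printing Implicit Defensive.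

Import Order.TTheory GRing.Theory Num.Theory.
Import numFieldNormedType.Exports.
Import Normc.

Local Open Scope classical_set_scope.
Local Open Scope ring_scope.

(* Coordinates are numbered from 0: the coordinate x_i (i >= 1) of the usual
   convention N = {1, 2, ...} is [x i.-1]. *)

(* A^N with the product of the discrete topologies. The letter [a0] only
   witnesses that A is nonempty; it provides the default element that
   measurable types are required to have. *)
Definition seq_topology (A : finType) (a0 : A) : Type :=
  prod_topology (fun _ : nat => discrete_topology A).

HB.instance Definition _ (A : finType) (a0 : A) :=
  Topological.on (seq_topology a0).
HB.instance Definition _ (A : finType) (a0 : A) :=
  isPointed.Build (seq_topology a0) (fun _ : nat => a0).

(* A^N with its Borel sigma-algebra. *)
Definition shift_space (A : finType) (a0 : A) : Type :=
  g_sigma_algebraType (@open (seq_topology a0)).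

HB.instance Definition _ (A : finType) (a0 : A) :=
  Measurable.on (shift_space a0).

Definition left_shift (A : Type) (x : nat -> A) : nat -> A := fun i => x i.+1.

Definition left_shift2 (A B : Type) (z : (nat -> A) * (nat -> B)) :
  (nat -> A) * (nat -> B) := (left_shift z.1, left_shift z.2).

Definition invariant_measure d (T : measurableType d) (R : realType)
    (mu : probability T R) (S : T -> T) : Prop :=
  forall E : set T, measurable E -> mu (S @^-1` E) = mu E.

Definition ergodic d (T : measurableType d) (R : realType)
    (mu : probability T R) (S : T -> T) : Prop :=
  invariant_measure mu S /\
  forall E : set T, measurable E -> S @^-1` E = E ->
    mu E = 0%E \/ mu E = 1%E.

Definition cylinder (A : Type) (m : nat) (B : m.-tuple A) : set (nat -> A) :=
  [set x | forall j : 'I_m, x j = tnth B j].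

Definition occurrences (A : finType) (x : nat -> A) (m : nat) (B : m.-tuple A)
    (n : nat) : nat :=
  #|[pred i : 'I_n | [forall j : 'I_m, x (i + j)%N == tnth B j]]|.

Definition generic (R : realType) (A : finType) (a0 : A) (x : nat -> A)
    (mu : probability (shift_space a0) R) : Prop :=
  forall (m : nat) (B : m.-tuple A), (0 < m)%N ->
    (fun n : nat => (occurrences x B n)%:R / n%:R : R) @ \oo
      --> fine (mu (cylinder B)).

Definition block_corr (R : realType) (n : nat) (a b : 'I_n -> R[i]) : R[i] :=
  n%:R^-1 * (\sum_(i < n) a i * (b i)^*)
  - (n%:R^-1 * \sum_(i < n) a i) * (n%:R^-1 * \sum_(i < n) (b i)^*).

Definition prefix_corr (R : realType) (x y : nat -> R[i]) (n : nat) : R[i] :=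
  block_corr (fun i : 'I_n => x i) (fun i : 'I_n => y i).

Definition weakly_correlated (R : realType) (x y : nat -> R[i]) : Prop :=
  (0 < limn_esup (fun n => (normc (prefix_corr x y n))%:E))%E.

Definition strongly_correlated (R : realType) (x y : nat -> R[i]) : Prop :=
  (0 < limn_einf (fun n => (normc (prefix_corr x y n))%:E))%E.

Definition complex_integral d (T : measurableType d) (R : realType)
    (mu : probability T R) (f : T -> R[i]) : R[i] :=
  Complex (\int[mu]_z complex.Re (f z)) (\int[mu]_z complex.Im (f z)).

(* The measurable structure on the product is the product of the two Borel
   sigma-algebras, which is the Borel sigma-algebra of the product space since
   both factors are second countable. *)
Definition joining (R : realType) (A : finType) (a0 : A)
    (mu nu : probability (shift_space a0) R)
    (xi : probability (shift_space a0 * shift_space a0)%type R) : Prop :=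
  [/\ invariant_measure xi (@left_shift2 A A),
      forall E : set (shift_space a0), measurable E -> xi (fst @^-1` E) = mu E
    & forall E : set (shift_space a0), measurable E -> xi (snd @^-1` E) = nu E].

Section measure_corr.
Variables (R : realType) (K : {fset R[i]}) (k0 : K).

(* the first-symbol function *)
Definition symbol1 (x : shift_space k0) : R[i] := val (x 0%N : K).

Definition measure_corr (mu nu : probability (shift_space k0) R) : R :=
  sup [set r : R | exists2 xi, joining mu nu xi
    & r = normc (complex_integral xi (fun z => symbol1 z.1 * (symbol1 z.2)^*)
                 - complex_integral mu symbol1
                   * complex_integral nu (fun y => (symbol1 y)^*))].

Definition correlated (mu nu : probability (shift_space k0) R) : Prop :=
  measure_corr mu nu != 0.

End measure_corr.

(* Main.v *)
(* Whether two sequences are correlated is read off the frequencies of the pairs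
   of letters, so everything happens for pairs of sequences, seen as sequences
   over the alphabet K * K.

   If x and y are generic for mu and nu, the block frequencies of (x, y) have
   limits along any ultrafilter containing the cofinite sets. These limits form
   a stationary law on words, which defines a joining xi of mu and nu; along an
   ultrafilter concentrated on the n for which |corr(x_[1,n], y_[1,n])| > delta,
   the correlation witnessed by xi is at least delta.

   Conversely, by a theorem of Kamae, if xi is a joining of mu and nu and x is
   generic for mu, then some y makes (x, y) generic for xi; hence y is generic for
   nu, and corr(x_[1,n], y_[1,n]) converges to the value given by xi. To find y,
   one cuts time into stretches of length (L + 1) * L, chooses in each stretch
   one of L phases, and fills the L windows of length L starting at that phase
   with blocks depending only on the window of x below. If the phase were
   uniform and the blocks drawn from the conditional law of xi, the expected
   frequencies of blocks would be almost right; a choice that always works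
   against the accumulated error keeps that error of order sqrt n. Letting the
   precision improve along the sequence gives y. *)

Require Import Defs.
From HB Require Import structures.
From mathcomp Require Import all_boot all_order all_algebra finmap.
From mathcomp Require Import complex.
From mathcomp Require Import all_classical all_reals all_analysis.
From mathcomp Require Import zify ring lra.

Set Implicit Arguments.
Unset Strict Implicit.
Unset Printing Implicit Defensive.

Import Order.TTheory GRing.Theory Num.Theory.
Import numFieldNormedType.Exports.

Local Open Scope classical_set_scope.
Local Open Scope ring_scope.

(** * Lifting generic points *)

Section finite_averages.
Variable R : realType.

(** If [f] exceeded its mean everywhere, the weighted deviations, which sum to zero, would force all
    weights to vanish. This is what replaces a random draw by a definite choice. *)
Lemma exists_le_avg (T : finType) (k f : T -> R) :
  (forall t, 0 <= k t) -> \sum_t k t = 1 ->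
  exists t, f t <= \sum_u k u * f u.
Proof.
move=> k0 k1; apply: contrapT => /forallNP fgt.
set m := \sum_u k u * f u in fgt.
have fm t : 0 < f t - m by rewrite subr_gt0 ltNge; apply/negP/fgt.
have : \sum_t k t * (f t - m) = 0.
  rewrite (eq_bigr (fun t => k t * f t - k t * m)); last by move=> t _; rewrite mulrBr.
  by rewrite sumrB -mulr_suml k1 mul1r subrr.
move=> /eqP; rewrite psumr_eq0; last by move=> t _; rewrite mulr_ge0// ltW.
move=> /allP h; have : \sum_t k t = 0.
  apply: big1 => t _; have /implyP/(_ erefl) := h t (mem_index_enum t).
  by rewrite mulf_eq0 (gt_eqF (fm t)) orbF => /eqP.
by rewrite k1 => /eqP; rewrite oner_eq0.
Qed.

(* Blackwell approachability: the choice at step [s] is taken against the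
   accumulated discrepancy, so the cross term in the square is nonpositive. *)
Lemma greedy_balance (I : finType) (U : Type) (V : nat -> U -> I -> R)
    (e : nat -> I -> R) (c : R) :
  (forall s u i, `|V s u i - e s i| <= c) ->
  (forall s (d : I -> R), exists u, \sum_i d i * V s u i <= \sum_i d i * e s i) ->
  exists u : nat -> U, forall S,
    \sum_i (\sum_(s < S) (V s (u s) i - e s i)) ^+ 2 <= S%:R * (#|I|%:R * c ^+ 2).
Proof.
move=> Vc h; pose pick s d := cid (h s d).
pose step s (d : I -> R) := projT1 (pick s d).
pose D := fix D s := if s is s'.+1 then
  (fun i => D s' i + (V s' (step s' (D s')) i - e s' i)) else (fun=> 0).
exists (fun s => step s (D s)) => S.
have DE s i : D s i = \sum_(t < s) (V t (step t (D t)) i - e t i).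
  by elim: s => [|s IH] /=; rewrite ?big_ord0// big_ord_recr/= IH.
under eq_bigr do rewrite -DE.
elim: S {DE} => [|s IH] /=.
  by rewrite mul0r big1// => i _; rewrite expr0n.
have := projT2 (pick s (D s)); rewrite -/(step s (D s)).
set u := step s (D s) => hu.
under eq_bigr do rewrite sqrrD.
rewrite !big_split/= -natr1 mulrDl mul1r -lerBrDr -[leRHS]addrC.
have c1 : \sum_i D s i * (V s u i - e s i) <= 0.
  by under eq_bigr do rewrite mulrBr; rewrite sumrB subr_le0.
have c2 : \sum_i (V s u i - e s i) ^+ 2 <= #|I|%:R * c ^+ 2.
  rewrite -sumr_const mulr_suml; apply: ler_sum => i _.
  by rewrite mul1r -real_normK ?num_real// lerXn2r// nnegrE (le_trans _ (Vc s u i)).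
lra.
Qed.

(** The sum of squares grows at most linearly in [S], so each coordinate of the discrepancy is at
    most of order the square root of [S], hence eventually below [del * S]. *)
Lemma greedy_balance_o (I : finType) (U : Type) (V : nat -> U -> I -> R)
    (e : nat -> I -> R) (c : R) :
  (forall s u i, `|V s u i - e s i| <= c) ->
  (forall s (d : I -> R), exists u, \sum_i d i * V s u i <= \sum_i d i * e s i) ->
  exists u : nat -> U, forall del, 0 < del -> exists N, forall S i, (N <= S)%N ->
    \sum_(s < S) e s i <= \sum_(s < S) V s (u s) i + del * S%:R.
Proof.
move=> Vc h; have [u hu] := greedy_balance Vc h; exists u => del del0.
set C := #|I|%:R * c ^+ 2 in hu.
have C0 : 0 <= C by rewrite mulr_ge0// sqr_ge0.
(* From this threshold on [C <= del ^+ 2 * S], so a square bounded by [S * C] is also bounded by the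
   square of [del * S]. *)
exists (Num.truncn (C / del ^+ 2)).+1 => S i NS.
have : C <= del ^+ 2 * S%:R.
  rewrite -ler_pdivrMl ?exprn_gt0// mulrC (le_trans (ltW (truncnS_gt _)))//.
  by rewrite ler_nat.
move=> CS; have := hu S; rewrite (bigD1 i)//=.
set X := \sum_(s < S) _ => XS.
have : 0 <= \sum_(j | j != i) (\sum_(s < S) (V s (u s) j - e s j)) ^+ 2.
  by apply: sumr_ge0 => j _; exact: sqr_ge0.
move=> r0; have : X ^+ 2 <= (del * S%:R) ^+ 2.
  have S0 : 0 <= S%:R :> R by [].
  rewrite (le_trans _ (_ : S%:R * C <= _)); nra.
move=> X2; have : `|X| <= del * S%:R.
  rewrite -(@ler_pXn2r _ 2)// ?nnegrE ?mulr_ge0// ?(ltW del0)//.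
  by rewrite real_normK ?num_real.
by rewrite ler_norml => /andP[+ _]; rewrite /X sumrB; lra.
Qed.

End finite_averages.

Lemma big_ord_mul (T : Type) (idx : T) (op : Monoid.law idx) (m n : nat)
    (F : nat -> T) :
  \big[op/idx]_(i < m * n) F i =
  \big[op/idx]_(i < m) \big[op/idx]_(j < n) F (i * n + j)%N.
Proof.
elim: m => [|m IH]; first by rewrite mul0n !big_ord0.
rewrite big_ord_recr/= -IH mulSn addnC big_split_ord/=.
by congr (op _ _).
Qed.

(** * Words, occurrences and stationary laws *)

Section words.
Variables (R : realType).

Definition block (C : Type) (z : nat -> C) (i m : nat) : seq C :=
  mkseq (fun j => z (i + j)%N) m.

(** An occurrence is counted by its starting position and may run past [n]. *)
Definition occ (C : eqType) (z : nat -> C) (w : seq C) (n : nat) : nat :=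
  \sum_(i < n) (block z i (size w) == w).

(** The inequality is multiplied through by [n], which keeps later estimates linear and makes
    [n = 0] harmless. *)
Definition has_freq (C : eqType) (z : nat -> C) (w : seq C) (p : R) :=
  forall e, 0 < e -> exists N, forall n, (N <= n)%N ->
    `|(occ z w n)%:R - p * n%:R| <= e * n%:R.

(* [P w] is the measure of the cylinder of [w] for a shift-invariant
   probability measure. *)
Definition stationary_law (C : finType) (P : seq C -> R) :=
  [/\ P [::] = 1, forall w, 0 <= P w,
      forall w, P w = \sum_c P (rcons w c) & forall w, P w = \sum_c P (c :: w)].

Lemma size_block (C : Type) (z : nat -> C) i m : size (block z i m) = m.
Proof. exact: size_mkseq. Qed.

Lemma block_tupleP (C : Type) (z : nat -> C) i m : size (block z i m) == m.
Proof. by rewrite size_block. Qed.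
Canonical block_tuple (C : Type) (z : nat -> C) i m := Tuple (block_tupleP z i m).

Lemma take_drop_block (C : Type) (z : nat -> C) i n o m : (o + m <= n)%N ->
  take m (drop o (block z i n)) = block z (i + o) m.
Proof.
move=> h; have c0 := z 0%N; apply: (@eq_from_nth _ c0).
  by rewrite size_takel ?size_drop ?size_block// leq_subRL; lia.
move=> j; rewrite size_takel ?size_drop ?size_block; last by lia.
move=> jm; rewrite nth_take// nth_drop !nth_mkseq//; last by lia.
by rewrite addnA.
Qed.

Lemma block_pair (A B : Type) (x : nat -> A) (y : nat -> B) i m :
  block (fun j => (x j, y j)) i m = zip (block x i m) (block y i m).
Proof.
rewrite /block /mkseq; elim: (iota 0 m) => //= j s -> //.
Qed.

Lemma occ_leq (C : eqType) (z : nat -> C) w n : (occ z w n <= n)%N.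
Proof.
rewrite -[leqRHS]card_ord -sum1_card; apply: leq_sum => i _.
exact: leq_b1.
Qed.

Lemma sum_tuple0 (C : finType) (F : seq C -> R) :
  \sum_(t : 0.-tuple C) F t = F [::].
Proof.
rewrite (big_pred1 [tuple]) // => t; apply/esym/eqP; exact: tuple0.
Qed.

Lemma sum_tuple_cons (C : finType) m (F : seq C -> R) :
  \sum_(t : m.+1.-tuple C) F t = \sum_c \sum_(t : m.-tuple C) F (c :: t).
Proof.
rewrite pair_big/= (reindex (fun p : C * m.-tuple C => [tuple of p.1 :: p.2]))//=.
exists (fun t : m.+1.-tuple C => (thead t, [tuple of behead t])) => [[c t] _|t _] /=.
  by congr pair; apply: val_inj.
by rewrite -tuple_eta.
Qed.

Lemma sum_tuple_rcons (C : finType) m (F : seq C -> R) :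
  \sum_(t : m.+1.-tuple C) F t = \sum_(t : m.-tuple C) \sum_c F (rcons t c).
Proof.
elim: m F => [|m IH] F.
  rewrite sum_tuple_cons (sum_tuple0 (fun s => \sum_c F (rcons s c))).
  by apply: eq_bigr => c _; rewrite (sum_tuple0 (fun s => F (c :: s))).
rewrite sum_tuple_cons (sum_tuple_cons _ (fun s => \sum_c F (rcons s c))).
by apply: eq_bigr => c _; rewrite (IH (fun s => F (c :: s))).
Qed.

Lemma sum_tuple_zip (A B : finType) m (F : seq (A * B) -> R) :
  \sum_(a : m.-tuple A) \sum_(b : m.-tuple B) F (zip a b) =
  \sum_(c : m.-tuple (A * B)) F c.
Proof.
elim: m F => [|m IH] F.
  rewrite sum_tuple0 (sum_tuple0 (fun s => \sum_(b : 0.-tuple B) F (zip s b))).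
  by rewrite (sum_tuple0 (fun s => F (zip [::] s))).
rewrite sum_tuple_cons (sum_tuple_cons _ (fun s => \sum_(b : m.+1.-tuple B) F (zip s b))).
rewrite [RHS](eq_bigr (fun p =>
  \sum_(t : m.-tuple (A * B)) F ((p.1, p.2) :: t))); last by case.
rewrite -(pair_big xpredT xpredT (fun a b => \sum_(t : m.-tuple (A * B)) F ((a, b) :: t)))/=.
apply: eq_bigr => a _.
under eq_bigr do rewrite (sum_tuple_cons _ (fun s => F (zip (a :: _) s))).
rewrite exchange_big; apply: eq_bigr => b _ /=.
by rewrite (IH (fun s => F ((a, b) :: s))).
Qed.

(** Grouping the positions by the word read there turns sums along [z] into sums over word
    counts. *)
Lemma sum_block (C : finType) (z : nat -> C) m (G : m.-tuple C -> R) n :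
  \sum_(i < n) G (block_tuple z i m) = \sum_a G a * (occ z a n)%:R.
Proof.
transitivity (\sum_(i < n) \sum_a G a * (block z i m == a :> seq C)%:R).
  apply: eq_bigr => i _; rewrite (bigD1 (block_tuple z i m))//= eqxx mulr1.
  rewrite big1 ?addr0// => a.
  by rewrite eq_sym -val_eqE /= => /negPf ->; rewrite mulr0.
rewrite exchange_big; apply: eq_bigr => a _.
rewrite -mulr_sumr /occ natr_sum; congr (_ * _).
by apply: eq_bigr => i _; rewrite size_tuple.
Qed.

Lemma sum_occ (C : finType) (z : nat -> C) m n :
  \sum_(a : m.-tuple C) (occ z a n)%:R = n%:R :> R.
Proof.
under eq_bigr do rewrite -[_%:R]mul1r.
rewrite -(sum_block z (fun=> 1)).
by rewrite sumr_const card_ord.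
Qed.

Lemma law_tuple (C : finType) (P : seq C -> R) m : stationary_law P ->
  \sum_(t : m.-tuple C) P t = 1.
Proof.
move=> [P0 _ Pr _]; elim: m => [|m IH]; first by rewrite sum_tuple0.
by rewrite sum_tuple_rcons -[RHS]IH; apply: eq_bigr => t _; rewrite -Pr.
Qed.

(** Letters after the factor are summed out by right consistency (induction on [r]), letters before
    it by left consistency (induction on [o]). *)
Lemma law_factor (C : finType) (P : seq C -> R) (w : seq C) m o :
  stationary_law P -> (o + size w <= m)%N ->
  \sum_(t : m.-tuple C) P t * (take (size w) (drop o t) == w)%:R = P w.
Proof.
move=> [_ _ Pr Pc] /subnKC <-; move: (m - _)%N => r {m}.
elim: r => [|r IH].
  rewrite addn0; elim: o => [|o IH].
    rewrite add0n (bigD1 (in_tuple w))//= drop0 take_size eqxx mulr1 big1 ?addr0//.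
    move=> t; rewrite drop0 take_oversize ?size_tuple// => /negPf.
    by rewrite -val_eqE /= => ->; rewrite mulr0.
  rewrite addSn (sum_tuple_cons _ (fun t => P t * (take (size w) (drop o.+1 t) == w)%:R)).
  rewrite exchange_big -[RHS]IH/=; apply: eq_bigr => t _.
  by rewrite -mulr_suml -Pc.
rewrite addnS (sum_tuple_rcons _ (fun t => P t * (take (size w) (drop o t) == w)%:R)).
rewrite -[RHS]IH; apply: eq_bigr => t _.
rewrite Pr mulr_suml; apply: eq_bigr => c _.
rewrite drop_rcons ?size_tuple; last by lia.
by rewrite -(cats1 (drop o t)) takel_cat// size_drop size_tuple; lia.
Qed.

End words.

(** * Filling the windows of a stretch *)

Section window_filling.
Variables (R : realType) (A B : finType).

(** Only occurrences lying inside [c] count: near the end of [c], [take] returns a word too short to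
    equal [w]. *)
Definition inner_occ (C : eqType) (w c : seq C) : nat :=
  \sum_(o < size c) (take (size w) (drop o c) == w).

Lemma inner_occ_leq (C : eqType) (w c : seq C) : (inner_occ w c <= size c)%N.
Proof.
rewrite -[leqRHS]card_ord -sum1_card; apply: leq_sum => i _.
exact: leq_b1.
Qed.

Lemma inner_occ_block (C : eqType) (z : nat -> C) (w : seq C) p L :
  (inner_occ w (block z p L) <= \sum_(o < L) (block z (p + o) (size w) == w))%N.
Proof.
rewrite /inner_occ size_block; apply: leq_sum => o _.
have [le_wL|lt_Lw] := leqP (o + size w) L; first by rewrite take_drop_block.
case: eqP => // /(congr1 size); rewrite size_take size_drop size_block.
by have oL := ltn_ord o; case: ltnP => h1 h2; exfalso; lia.
Qed.

Variables (b0 : B) (x : nat -> A) (L : nat) (I : finType) (wd : I -> seq (A * B)).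
Variable k : L.-tuple A -> L.-tuple B -> R.
Hypotheses (L0 : (0 < L)%N) (k0 : forall a b, 0 <= k a b)
  (k1 : forall a, \sum_b k a b = 1).

(** A stretch of this length has room for [L] consecutive windows starting at any phase [r < L]. *)
Let W := (L.+1 * L)%N.

(** Conditional expectation of the number of occurrences of [w] in a window, given its upper word
    [a]. *)
Definition mean_inner_occ w (a : L.-tuple A) : R :=
  \sum_b k a b * (inner_occ w (zip a b))%:R.

Lemma mean_inner_occ_ge0 w a : 0 <= mean_inner_occ w a.
Proof. by apply: sumr_ge0 => b _; rewrite mulr_ge0. Qed.

Lemma mean_inner_occ_le w a : mean_inner_occ w a <= L%:R.
Proof.
apply: (@le_trans _ _ (\sum_b k a b * L%:R)); last by rewrite -mulr_suml k1 mul1r.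
apply: ler_sum => b _; rewrite ler_wpM2l ?k0// ler_nat (leq_trans (inner_occ_leq _ _))//.
by rewrite size_zip !size_tuple minnn.
Qed.

Let win s r j := block_tuple x (s * W + r + j * L) L.

(** [(u s).1] is the phase chosen in stretch [s], and [(u s).2] sends the window of [x] to the block
    written below it. In the margins, where the subtraction may truncate, the formula still yields
    some letter; occurrences starting there are only bounded below by zero. *)
Let fill (u : nat -> 'I_L * (L.-tuple A -> L.-tuple B)) (i : nat) : B :=
  let s := (i %/ W)%N in let q := (i %% W - (u s).1)%N in
  nth b0 ((u s).2 (win s (u s).1 (q %/ L))) (q %% L).

Let fill_window u s (j : 'I_L) :
  block (fill u) (s * W + (u s).1 + j * L) L = (u s).2 (win s (u s).1 j).
Proof.
apply: (@eq_from_nth _ b0); rewrite size_block ?size_tuple// => o oL.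
rewrite nth_mkseq// /fill.
have rL := ltn_ord (u s).1; have jL := ltn_ord j.
have qW : ((u s).1 + j * L + o < W)%N by rewrite /W; nia.
have -> : (s * W + (u s).1 + j * L + o = s * W + ((u s).1 + j * L + o))%N by lia.
have W0 : (0 < W)%N by lia.
rewrite divnMDl// divn_small// addn0 modnMDl modn_small//.
have -> : ((u s).1 + j * L + o - (u s).1 = j * L + o)%N by lia.
by rewrite divnMDl// divn_small// addn0 modnMDl modn_small.
Qed.

(** The windows are disjoint and stay inside their stretch, so occurrences inside them are distinct;
    those cut by a window edge or lying in the margins are dropped, whence an inequality. *)
Let occ_fill (u : nat -> 'I_L * (L.-tuple A -> L.-tuple B)) (w : seq (A * B)) S :
  (\sum_(s < S) \sum_(j < L)
     inner_occ w (zip (win s (u s).1 j) ((u s).2 (win s (u s).1 j)))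
   <= occ (fun i => (x i, fill u i)) w (S * W))%N.
Proof.
pose z i := (x i, fill u i); pose g i := (block z i (size w) == w : nat).
have occD n m : (occ z w n + \sum_(i < m) g (n + i) = occ z w (n + m))%N.
  by rewrite /occ big_split_ord.
elim: S => [|S IH]; first by rewrite big_ord0.
rewrite big_ord_recr/= mulSn addnC [(W + _)%N]addnC -occD addnC leq_add//.
set r := (u S).1; apply: (@leq_trans
  (\sum_(j < L) \sum_(o < L) g (S * W + r + (j * L + o)))%N).
  apply: leq_sum => j _; rewrite -fill_window -block_pair.
  apply: leq_trans (inner_occ_block _ _ _ _) _.
  by rewrite leq_eqVlt; apply/orP; left; apply/eqP; apply: eq_bigr => o _; rewrite /g addnA.
have -> : (\sum_(j < L) \sum_(o < L) g (S * W + r + (j * L + o)) =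
    \sum_(i < L * L) g (S * W + r + i))%N.
  by rewrite (big_ord_mul _ _ _ (fun i => g (S * W + r + i)%N)).
(* The stretch splits into a margin of length [r], the positions of the windows, and a margin of
   length [L - r]. *)
have rW : (r + (L * L + (L - r)) = W)%N by have := ltn_ord r; rewrite /W; nia.
have -> : (\sum_(i < W) g (S * W + i) =
  \sum_(i < r + (L * L + (L - r))) g (S * W + i))%N by rewrite rW.
rewrite big_split_ord/= big_split_ord/= addnCA.
under [X in (_ <= X + _)%N]eq_bigr do rewrite addnA.
exact: leq_addr.
Qed.

(** The left side is the expected number of occurrences for a uniform phase and blocks drawn from
    [k]; greedy choices reach it up to an error sublinear in [S]. *)
Lemma exists_filling : exists y : nat -> B, forall del, 0 < del ->
  exists N, forall S i, (N <= S)%N ->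
    \sum_(s < S) L%:R^-1 * \sum_(p < L * L)
        mean_inner_occ (wd i) (block_tuple x (s * W + p) L)
    <= (occ (fun i => (x i, y i)) (wd i) (S * W))%:R + del * S%:R.
Proof.
(* [V] is the gain of a choice in stretch [s], and [e] its expectation. *)
pose V s (u : 'I_L * (L.-tuple A -> L.-tuple B)) i : R :=
  \sum_(j < L) (inner_occ (wd i) (zip (win s u.1 j) (u.2 (win s u.1 j))))%:R.
pose e s i : R := L%:R^-1 * \sum_(r < L) \sum_(j < L) mean_inner_occ (wd i) (win s r j).
have Lr : 0 < L%:R :> R by rewrite ltr0n.
have L1 : \sum_(r < L) L%:R^-1 = 1 :> R.
  by rewrite sumr_const card_ord -[LHS]mulr_natr mulVf ?gt_eqF.
have V0 s u i : 0 <= V s u i <= L%:R * L%:R.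
  rewrite sumr_ge0//= -natrM -[X in (X * _)%N]card_ord -sum_nat_const natr_sum.
  apply: ler_sum => j _; rewrite ler_nat (leq_trans (inner_occ_leq _ _))//.
  by rewrite size_zip !size_tuple minnn.
have e0 s i : 0 <= e s i <= L%:R * L%:R.
  apply/andP; split.
    rewrite mulr_ge0// ?invr_ge0 ?(ltW Lr)//.
    by apply: sumr_ge0 => r _; apply: sumr_ge0 => j _; exact: mean_inner_occ_ge0.
  have -> : L%:R * L%:R = L%:R^-1 * \sum_(r < L) \sum_(j < L) L%:R :> R.
    rewrite !sumr_const !card_ord -[(_ *+ L) *+ L]mulr_natl mulKf ?gt_eqF//.
    by rewrite -[RHS]mulr_natl.
  rewrite ler_pM2l ?invr_gt0//; apply: ler_sum => r _; apply: ler_sum => j _.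
  exact: mean_inner_occ_le.
have [||u hu] := @greedy_balance_o R I _ V e (L%:R * L%:R).
- move=> s u i; rewrite ler_norml; have := V0 s u i; have := e0 s i.
  by move=> /andP[? ?] /andP[? ?]; apply/andP; split; lra.
- move=> s d.
  (* The choice against [d] is made by two averagings: first a block for each possible window of
     [x], then a phase. *)
  have bex (a : L.-tuple A) : exists b : L.-tuple B,
      \sum_i d i * (inner_occ (wd i) (zip a b))%:R <= \sum_i d i * mean_inner_occ (wd i) a.
    have [b hb] := exists_le_avg (fun b : L.-tuple B =>
      \sum_i d i * (inner_occ (wd i) (zip a b))%:R) (k0 a) (k1 a).
    exists b; apply: le_trans hb _; rewrite le_eqVlt; apply/orP; left; apply/eqP.
    under eq_bigr do rewrite mulr_sumr.
    rewrite exchange_big; apply: eq_bigr => i _; rewrite mulr_sumr.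
    by apply: eq_bigr => b' _; rewrite mulrCA.
  pose phi a := projT1 (cid (bex a)).
  have phiP a := projT2 (cid (bex a)); rewrite -/(phi _) in phiP.
  have Li (r : 'I_L) : 0 <= L%:R^-1 :> R by rewrite invr_ge0 ltW.
  have [r hr] := exists_le_avg (fun r : 'I_L => \sum_(j < L) \sum_i
    d i * mean_inner_occ (wd i) (win s r j)) Li L1.
  exists (r, phi); rewrite /V /=.
  under eq_bigr do rewrite mulr_sumr.
  rewrite exchange_big/=; apply: (@le_trans _ _ (\sum_(j < L) \sum_i
    d i * mean_inner_occ (wd i) (win s r j))).
    by apply: ler_sum => j _; exact: phiP.
  apply: le_trans hr _; rewrite le_eqVlt; apply/orP; left; apply/eqP.
  rewrite -mulr_sumr /e; under [RHS]eq_bigr do rewrite mulrCA.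
  rewrite -mulr_sumr; congr (_ * _).
  under [RHS]eq_bigr do rewrite mulr_sumr.
  rewrite [RHS]exchange_big/=; apply: eq_bigr => r' _.
  by rewrite exchange_big/=; apply: eq_bigr => i _; rewrite mulr_sumr.
exists (fill u) => del /hu[N hN]; exists N => S i NS.
have := hN S i NS.
have -> : \sum_(s < S) e s i = \sum_(s < S) L%:R^-1 * \sum_(p < L * L)
        mean_inner_occ (wd i) (block_tuple x (s * W + p) L).
  apply: eq_bigr => s _; congr (_ * _).
  (* As phase [r] and window [j] vary, the start [j * L + r] runs exactly once through the offsets
     below [L * L]. *)
  rewrite (big_ord_mul _ _ _ (fun p => mean_inner_occ (wd i) (block_tuple x (s * W + p) L))).
  rewrite exchange_big; apply: eq_bigr => j _; apply: eq_bigr => r _.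
  by congr mean_inner_occ; apply: val_inj => /=; congr block; lia.
move=> /le_trans; apply; rewrite lerD2r.
apply: le_trans (_ : (_ : nat)%:R <= _); last by rewrite ler_nat; exact: (occ_fill u (wd i) S).
by rewrite natr_sum; apply: ler_sum => s _; rewrite natr_sum.
Qed.

End window_filling.

(** * Approximate lifts *)

Section finite_lifting.
Variables (R : realType) (A B : finType).

Lemma finite_uniform_bound (I : finType) (Q : I -> nat -> Prop) :
  (forall i, exists N, forall n, (N <= n)%N -> Q i n) ->
  exists N, forall n i, (N <= n)%N -> Q i n.
Proof.
move=> /(_ _)/cid h; exists (\max_i projT1 (h i)) => n i Nn.
by apply: (projT2 (h i)); rewrite (leq_trans _ Nn)// leq_bigmax.
Qed.

Lemma law_le1 (C : finType) (P : seq C -> R) w : stationary_law P -> P w <= 1.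
Proof.
move=> Pl; rewrite -(law_tuple (size w) Pl) (bigD1 (in_tuple w))//= lerDl.
by apply: sumr_ge0 => t _; case: Pl.
Qed.

Variables (P : seq (A * B) -> R) (Pl : stationary_law P) (b0 : B).

Definition fst_law (a : seq A) : R := \sum_(b : (size a).-tuple B) P (zip a b).

Lemma fst_law_tuple L (a : L.-tuple A) : fst_law a = \sum_(b : L.-tuple B) P (zip a b).
Proof. by rewrite /fst_law; case: a => a /= sa; move/eqP: (sa) => sL; subst L. Qed.

(* Any law will do given a word of measure zero; the constant word [b0 ... b0]
   is used. *)
Definition cond_law L (a : L.-tuple A) (b : L.-tuple B) : R :=
  if fst_law a == 0 then (b == nseq_tuple L b0)%:R else P (zip a b) / fst_law a.

Lemma fst_law_ge0 a : 0 <= fst_law a.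
Proof. by apply: sumr_ge0 => b _; case: Pl. Qed.

Lemma cond_law_ge0 L (a : L.-tuple A) b : 0 <= cond_law a b.
Proof.
rewrite /cond_law; case: ifP => // _; rewrite divr_ge0 ?fst_law_ge0//.
by case: Pl.
Qed.

Lemma cond_law_sum1 L (a : L.-tuple A) : \sum_b cond_law a b = 1.
Proof.
rewrite /cond_law; have [_|a0] := eqVneq (fst_law a) 0; last first.
  by rewrite -mulr_suml -fst_law_tuple divff.
rewrite (bigD1 (nseq_tuple L b0))//= eqxx big1 ?addr0// => b /negPf.
by move=> ->.
Qed.

(** When the marginal vanishes, so does every term [P (zip a b)] of the nonnegative sum defining
    it. *)
Lemma fst_cond_law L (a : L.-tuple A) b : fst_law a * cond_law a b = P (zip a b).
Proof.
rewrite /cond_law; case: ifPn => [/eqP a0|a0]; last by rewrite mulrC divfK.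
rewrite a0 mul0r; apply/esym/eqP; move/eqP: a0.
rewrite fst_law_tuple psumr_eq0; last by move=> c _; case: Pl.
by move=> /allP/(_ b (mem_index_enum b))/implyP/(_ erefl).
Qed.

(** By [fst_cond_law], the right side is the expected number of occurrences of [w] in a word of
    length [L] drawn from [P]. Each offset below [L - size w] contributes [P w], the others at least
    zero. *)
Lemma sum_mean_inner_occ L w : (size w <= L)%N ->
  (L - size w)%:R * P w <=
  \sum_(a : L.-tuple A) fst_law a * mean_inner_occ (@cond_law L) w a.
Proof.
move=> wL.
have -> : \sum_(a : L.-tuple A) fst_law a * mean_inner_occ (@cond_law L) w a =
    \sum_(c : L.-tuple (A * B)) P c * (inner_occ w c)%:R.
  rewrite -(sum_tuple_zip L (fun c => P c * (inner_occ w c)%:R)).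
  apply: eq_bigr => a _; rewrite /mean_inner_occ mulr_sumr.
  by apply: eq_bigr => b _; rewrite mulrA fst_cond_law.
have -> : \sum_(c : L.-tuple (A * B)) P c * (inner_occ w c)%:R =
    \sum_(o < L) \sum_(c : L.-tuple (A * B)) P c * (take (size w) (drop o c) == w)%:R.
  rewrite exchange_big; apply: eq_bigr => c _.
  by rewrite /inner_occ size_tuple natr_sum mulr_sumr.
rewrite (bigID (fun o : 'I_L => (o < L - size w)%N))/=.
apply: ler_wpDr.
  by apply: sumr_ge0 => o _; apply: sumr_ge0 => c _; rewrite mulr_ge0//; case: Pl.
rewrite (eq_bigr (fun=> P w)) => [|o ow]; last first.
  by rewrite law_factor// addnC -leq_subRL// ltnW.
by rewrite (big_ord_narrow (leq_subr _ _)) sumr_const card_ord mulr_natl.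
Qed.

Variable x : nat -> A.
Hypothesis x_freq : forall a, has_freq x a (fst_law a).

(** The windows are filled according to the conditional law of [P]. A lower bound is enough at this
    stage: the upper one will follow because frequencies of words of one length add up to 1. *)
Lemma exists_lower_freq (I : finType) (wd : I -> seq (A * B)) (e : R) : 0 < e ->
  exists y N, forall n i, (N <= n)%N ->
    P (wd i) * n%:R - e * n%:R <= (occ (fun j => (x j, y j)) (wd i) n)%:R.
Proof.
move=> e0; pose K := \max_i size (wd i).
have wK i : (size (wd i) <= K)%N by rewrite /K (leq_bigmax i).
(* Four errors of size [d] are allowed: the greedy choices, the word frequencies of [x] up to [n],
   the edge effects in windows and stretches, and the last incomplete stretch. *)
pose d := e / 4; have d0 : 0 < d by rewrite divr_gt0.
(* In [K.+1 <= d * L], the part [K] pays for occurrences cut at window ends, and the extra 1 for the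
   last [L] starts of each stretch, which the average does not visit. *)
pose L := maxn K.+1 (Num.truncn (K.+1%:R / d)).+1.
have L0 : (0 < L)%N by rewrite /L; lia.
have KL : K.+1%:R <= d * L%:R.
  rewrite -ler_pdivrMl// mulrC (le_trans (ltW (truncnS_gt _)))//.
  by rewrite ler_nat leq_maxr.
have KL' : (K <= L)%N by rewrite /L; lia.
pose W := (L.+1 * L)%N.
pose E i := mean_inner_occ (@cond_law L) (wd i).
have E0 i a : 0 <= E i a by apply: mean_inner_occ_ge0; exact: cond_law_ge0.
have EL i a : E i a <= L%:R.
  by apply: mean_inner_occ_le; [exact: cond_law_ge0|exact: cond_law_sum1].
have [y hy] := exists_filling b0 x wd L0 (@cond_law_ge0 L) (@cond_law_sum1 L).
have [N1 hN1] := hy d d0.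
(* [Q] exceeds [L] times the number of words of length [L], so frequency errors [d / Q], each
   weighted by at most [L], add up to at most [d]. *)
pose Q : R := (#|{: L.-tuple A}| * L).+1%:R.
have Q0 : 0 < Q by rewrite ltr0n.
have [N2 hN2] : exists N, forall n (a : L.-tuple A), (N <= n)%N ->
    `|(occ x a n)%:R - fst_law a * n%:R| <= d / Q * n%:R.
  by apply: finite_uniform_bound => a; apply: x_freq; exact: divr_gt0.
exists y, (maxn (N1 * W) (maxn N2 (Num.truncn (W%:R / d)).+1)) => n i.
rewrite !geq_max => /and3P[nN1 nN2 nW].
have W0 : (0 < W)%N by rewrite /W; nia.
have dn : W%:R <= d * n%:R.
  rewrite -ler_pdivrMl// mulrC (le_trans (ltW (truncnS_gt _)))//.
  by rewrite ler_nat.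
set S := (n %/ W)%N.
have SN : (N1 <= S)%N by rewrite /S leq_divRL.
have SWn : (S * W <= n)%N by exact: leq_trunc_div.
have nSW : (n <= S.+1 * W)%N by rewrite ltnW// ltn_ceil.
pose g p : R := E i (block_tuple x p L).
set z := fun j => (x j, y j).
have hlow : L%:R^-1 * \sum_(s < S) \sum_(p < L * L) g (s * W + p)%N <=
  (occ z (wd i) (S * W))%:R + d * S%:R by rewrite mulr_sumr; exact: hN1.
have occ_n : (occ z (wd i) (S * W))%:R <= (occ z (wd i) n)%:R :> R.
  rewrite ler_nat /occ -(subnKC SWn) big_split_ord/=.
  exact: leq_addr.
(* Passing to all starting positions adds the last [L] starts of each full stretch and one further
   stretch, every start weighing at most [L]. *)
have sum_g : \sum_(p < n) g p <=
    \sum_(s < S) \sum_(p < L * L) g (s * W + p)%N + S%:R * (L%:R * L%:R) + W%:R * L%:R.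
  apply: (@le_trans _ _ (\sum_(p < S.+1 * W) g p)).
    rewrite -(subnKC nSW) big_split_ord/= lerDl.
    by apply: sumr_ge0 => p _; exact: E0.
  rewrite big_ord_mul big_ord_recr/=; apply: lerD; last first.
    rewrite mulr_natl -[X in _ *+ X]card_ord -sumr_const.
    by apply: ler_sum => p _; exact: EL.
  rewrite mulr_natl -[X in _ *+ X]card_ord -sumr_const -big_split/=.
  apply: ler_sum => s _; have -> : \sum_(p < W) g (s * W + p)%N =
      \sum_(p < L * L + L) g (s * W + p)%N by rewrite /W mulSn addnC.
  rewrite big_split_ord lerD2l mulr_natl -[X in _ *+ X]card_ord -sumr_const.
  by apply: ler_sum => p _; exact: EL.
have low_g : \sum_(a : L.-tuple A) fst_law a * E i a * n%:R - d * n%:R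
    <= \sum_(p < n) g p.
  rewrite (sum_block x (E i)).
  rewrite lerBlDr -lerBlDl -sumrB.
  apply: (@le_trans _ _ (\sum_(a : L.-tuple A) L%:R * (d / Q * n%:R))).
    apply: ler_sum => a _.
    have := hN2 n a nN2; rewrite ler_norml => /andP[h _].
    have dQ : 0 <= d / Q * n%:R by rewrite mulr_ge0// ltW// divr_gt0.
    have := E0 i a; have := EL i a; set u := E i a; set v := d / Q * n%:R in h dQ *.
    by move=> uL u0; rewrite (mulrC _ u) -mulrA -mulrBr; nra.
  rewrite sumr_const -[leLHS]mulr_natl mulrA -natrM [_ * (d / Q * _)]mulrA ler_wpM2r//.
  rewrite mulrCA ger_pMr// ler_pdivrMr// mul1r ler_nat.
  exact: leqnSn.
have main := sum_mean_inner_occ (leq_trans (wK i) KL').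
rewrite natrB ?(leq_trans (wK i) KL')// in main.
rewrite -mulr_suml -/(E i) in low_g.
set M := \sum_(a : _.-tuple _) _ in low_g main.
have P1 : P (wd i) <= 1 by exact: law_le1.
have P0 : 0 <= P (wd i) by case: Pl.
have wKR : (size (wd i))%:R <= K%:R :> R by rewrite ler_nat.
have n0 : 0 <= n%:R :> R by [].
have Lr : 1 <= L%:R :> R by rewrite ler1n.
have SWr : S%:R * (L%:R * L%:R) + S%:R * L%:R <= n%:R :> R.
  by rewrite -!natrM -natrD ler_nat (leq_trans _ SWn)// /W mulSn mulnDr addnC.
have S0 : 0 <= S%:R :> R by [].
have ed : e = 4 * d by rewrite /d; field.
rewrite -(ler_pM2l (_ : 0 < L%:R)) ?ltr0n//.
rewrite ler_pdivrMl ?ltr0n// in hlow.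
have h1 : (K.+1%:R) * n%:R <= d * L%:R * n%:R by rewrite ler_wpM2r.
have h2 : (size (wd i))%:R * P (wd i) * n%:R <= K%:R * n%:R.
  by rewrite ler_wpM2r// (le_trans _ wKR)// ler_piMr.
have h3 : (L%:R - (size (wd i))%:R) * P (wd i) * n%:R <= M * n%:R by rewrite ler_wpM2r.
have h4 : d * n%:R <= d * L%:R * n%:R by rewrite ler_wpM2r// ler_peMr// ltW.
have h5 : W%:R * L%:R <= d * L%:R * n%:R by rewrite mulrAC ler_wpM2r.
have Sn : S%:R <= n%:R :> R by rewrite ler_nat leq_div.
have h6 : L%:R * (d * S%:R) <= d * L%:R * n%:R.
  rewrite mulrA [L%:R * d]mulrC; apply: ler_wpM2l Sn.
  by rewrite mulr_ge0// ltW.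
have h7 : L%:R * (occ z (wd i) (S * W))%:R <= L%:R * (occ z (wd i) n)%:R :> R.
  by rewrite ler_wpM2l.
have h8 : 0 <= S%:R * L%:R :> R by rewrite mulr_ge0.
rewrite /g in sum_g low_g.
rewrite -natr1 in h1.
rewrite ed; lra.
Qed.

(** Word counts of one length sum to [n] and the law sums to 1, so an excess on one word would be a
    deficit on the others, which the lower bounds limit. *)
Lemma exists_approx_freq (K : nat) (e : R) : 0 < e ->
  exists y N, forall n w, (N <= n)%N -> (size w <= K)%N ->
    `|(occ (fun j => (x j, y j)) w n)%:R - P w * n%:R| <= e * n%:R.
Proof.
move=> e0; pose I := {m : 'I_K.+1 & m.-tuple (A * B)}.
(* [Q] bounds the number of words of any length at most [K]; the successor keeps the base
   positive. *)
pose Q : R := (#|{: A * B}|.+1 ^ K)%:R.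
have Q0 : 0 < Q by rewrite ltr0n expn_gt0.
have Q1 : 1 <= Q by rewrite ler1n expn_gt0.
have [y [N hN]] := exists_lower_freq (fun i : I => val (tagged i)) (divr_gt0 e0 Q0).
exists y, N => n w Nn wK.
have low (v : (size w).-tuple (A * B)) :=
  hN n (existT _ (Ordinal (wK : (size w < K.+1)%N)) v) Nn.
rewrite /= in low.
set z := fun j => (x j, y j) in low *.
have eQ : e / Q <= e by rewrite ler_pdivrMr// ler_peMr// ltW.
have n0 : 0 <= n%:R :> R by [].
rewrite ler_norml; apply/andP; split.
  have := low (in_tuple w) => /=.
  have : e / Q * n%:R <= e * n%:R by rewrite ler_wpM2r.
  lra.
have := sum_occ R z (size w) n; rewrite (bigD1 (in_tuple w))//=.
have := law_tuple (size w) Pl; rewrite (bigD1 (in_tuple w))//=.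
set s1 := \sum_(i | _) P _; set s2 := \sum_(i | _) (occ _ _ _)%:R.
move=> sP so.
have : s1 * n%:R - e * n%:R <= s2.
  rewrite lerBlDr -lerBlDl mulr_suml -sumrB.
  apply: (@le_trans _ _ (\sum_(v : (size w).-tuple (A * B) | v != in_tuple w) e / Q * n%:R)).
    by apply: ler_sum => v _; have := low v; lra.
  rewrite -mulr_suml ler_wpM2r// sumr_const -mulr_natr mulrAC ler_pdivrMr//.
  rewrite ler_pM2l// ler_nat (leq_trans (max_card _))// card_tuple.
  apply: (@leq_trans (#|{: A * B}|.+1 ^ size w)); last exact: leq_pexp2l.
  by case: (size w) => // m; rewrite leq_exp2r.
have -> : s1 = 1 - P w by lra.
lra.
Qed.

End finite_lifting.

(** * Concatenating approximations of increasing precision *)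

Section concatenation.
Variables (R : realType) (C : finType).

(** Between [a] and [n], only the last [size w] starting positions can have a window that leaves the
    zone of agreement. *)
Lemma occ_agree (u v : nat -> C) (w : seq C) a b n :
  (forall i, (a <= i < b)%N -> u i = v i) -> (a <= n <= b)%N ->
  (occ u w n + occ v w a <= occ v w n + occ u w a + size w)%N.
Proof.
move=> uv /andP[an nb]; move: an nb => /subnKC <-; move: (n - a)%N => t tb.
rewrite /occ !big_split_ord/=.
have arith (p q r s m : nat) : (r <= s + m -> p + r + q <= q + s + p + m)%N by lia.
apply: arith.
have -> : t = (t - size w + minn t (size w))%N by lia.
rewrite !big_split_ord/= -addnA leq_add//.
  apply: leq_sum => i _; rewrite (_ : block u _ _ = block v (a + i) (size w))//.
  apply/eq_in_map => j; rewrite mem_iota => jw; apply: uv.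
  by have := ltn_ord i; lia.
rewrite (@leq_trans (minn t (size w)))//; last first.
  by rewrite (leq_trans _ (leq_addl _ _))// geq_minr.
rewrite -[leqRHS]card_ord -sum1_card; apply: leq_sum => i _.
exact: leq_b1.
Qed.

(** The sequence follows [Z k] from time [T k] to time [T k.+1], each stage being long enough to
    make all earlier errors negligible. *)
Lemma exists_diagonal_freq (P : seq C -> R) (Z : nat -> nat -> C) :
  (forall w, 0 <= P w <= 1) ->
  (forall k, exists N, forall n w, (N <= n)%N -> (size w <= k)%N ->
    `|(occ (Z k) w n)%:R - P w * n%:R| <= k.+1%:R^-1 * n%:R) ->
  exists kap : nat -> nat, forall w, has_freq (fun i => Z (kap i) i) w (P w).
Proof.
move=> P01 /(_ _)/cid hN; pose N k := projT1 (hN k).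
have NP k := projT2 (hN k); rewrite -/(N _) in NP.
(* The term [N k] makes the estimate for [Z k] valid from the start of its stage; the product makes
   the past and the edge error at most a fraction [k.+1%:R^-1] of the time [T k.+1]. *)
pose T := fix T k := if k is k'.+1 then (N k + k.+1 * (T k' + k))%N else N 0%N.
have TS k : T k.+1 = (N k.+1 + k.+2 * (T k + k.+1))%N by [].
have NT k : (N k <= T k)%N by case: k => //= k; rewrite leq_addr.
have Tlt k : (T k < T k.+1)%N by rewrite TS; nia.
have Tle := homo_leq (@leqnn) leq_trans (fun k => ltnW (Tlt k)).
have kT k : (k <= T k)%N by elim: k => // k IH; have := Tlt k; lia.
(* The last stage begun by time [i], or 0 before [T 0]. Restricting to [k < i.+1] loses nothing,
   since [k <= T k]. *)
pose kap i := \max_(k < i.+1 | (T k <= i)%N) k.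
have kapE k i : (T k <= i < T k.+1)%N -> kap i = k.
  move=> /andP[ki ik]; apply/eqP; rewrite eqn_leq; apply/andP; split.
    apply/bigmax_leqP => j Tj; rewrite leqNgt; apply/negP => /Tle.
    by rewrite leqNgt (leq_ltn_trans Tj).
  have ki1 : (k < i.+1)%N by rewrite ltnS (leq_trans (kT k)).
  by rewrite /kap (bigD1 (Ordinal ki1))//= leq_maxl.
exists kap => w e e0; set z := fun i => Z (kap i) i; set m := size w.
have triv n : `|(occ z w n)%:R - P w * n%:R| <= n%:R.
  have /andP[P0 P1] := P01 w.
  have : (occ z w n)%:R <= n%:R :> R by rewrite ler_nat occ_leq.
  have : 0 <= (occ z w n)%:R :> R by [].
  have : 0 <= P w * n%:R by rewrite mulr_ge0.
  have : P w * n%:R <= n%:R by rewrite ler_piMl.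
  by move=> ? ? ? ?; rewrite ler_norml; apply/andP; split; lra.
have step k n : (m <= k)%N -> (T k <= n <= T k.+1)%N ->
    `|(occ z w n)%:R - P w * n%:R| <=
    `|(occ z w (T k))%:R - P w * (T k)%:R| + k.+1%:R^-1 * (n%:R + (T k)%:R) + m%:R.
  move=> mk kn; have ag i : (T k <= i < T k.+1)%N -> z i = Z k i.
    by move=> /kapE; rewrite /z => ->.
  have ag' i : (T k <= i < T k.+1)%N -> Z k i = z i by move/ag.
  have h1 := occ_agree w ag kn; have h2 := occ_agree w ag' kn.
  have /andP[kn1 _] := kn.
  have g1 := NP k n w (leq_trans (NT k) kn1) mk.
  have g2 := NP k (T k) w (NT k) mk.
  move: h1 h2; rewrite -!(ler_nat R) !natrD -/m => h1 h2.
  have Du := ler_norm ((occ z w (T k))%:R - P w * (T k)%:R).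
  have Dl := lerNnormlW (lexx `|(occ z w (T k))%:R - P w * (T k)%:R|).
  move: g1 g2; rewrite mulrDr ler_norml => /andP[g1 g1'].
  rewrite ler_norml => /andP[g2 g2'].
  move: (k.+1%:R^-1) g1 g1' g2 g2' => q g1 g1' g2 g2'.
  by rewrite ler_norml; apply/andP; split; lra.
(* One third of the bound absorbs the trivial error at [T k] together with [m]; the two others come
   from the estimates for [Z k] at both ends of the stage. *)
have Tk k : (m <= k)%N ->
    `|(occ z w (T k.+1))%:R - P w * (T k.+1)%:R| <= 3 * k.+1%:R^-1 * (T k.+1)%:R.
  move=> mk; have := step k (T k.+1) mk; rewrite ltnW// leqnn => /(_ erefl).
  have := triv (T k); have k0 : 0 < k.+1%:R :> R by rewrite ltr0n.
  have : (T k)%:R + m%:R <= k.+1%:R^-1 * (T k.+1)%:R :> R.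
    by rewrite ler_pdivlMl// -natrD -natrM ler_nat TS; nia.
  have : k.+1%:R^-1 * (T k)%:R <= k.+1%:R^-1 * (T k.+1)%:R :> R.
    by rewrite ler_wpM2l ?invr_ge0// ler_nat ltnW.
  by move: (k.+1%:R^-1) => q; lra.
(* The 6 is 3 for the error at the start of the current stage, 2 for the estimates at [n] and at
   that start, and 1 for the edge error [m]. *)
pose k1 := (m + (Num.truncn (6 / e)).+1)%N.
exists (T k1.+1) => n nk1.
have [k [k1k kn nk]] : exists k, [/\ (k1 <= k)%N, (T k.+1 <= n)%N & (n < T k.+2)%N].
  have ex : exists k, (T k.+1 <= n)%N by exists k1.
  have bd k : (T k.+1 <= n)%N -> (k <= n)%N by have := kT k.+1; lia.
  case: (ex_maxnP ex bd) => k kn kmax; exists k; split => //; first exact: kmax.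
  by rewrite ltnNge; apply/negP => /kmax; rewrite ltnn.
have mk : (m <= k)%N by rewrite (leq_trans _ k1k)// leq_addr.
have := step k.+1 n (leqW mk); rewrite kn (ltnW nk) => /(_ erefl).
have := Tk k mk.
have k0 : 0 < k.+1%:R :> R by rewrite ltr0n.
have kk : k.+2%:R^-1 <= k.+1%:R^-1 :> R by rewrite lef_pV2 ?posrE ?ltr0n// ler_nat.
have ke : 6 * k.+1%:R^-1 <= e.
  rewrite ler_pdivrMr// mulrC -ler_pdivrMr// (le_trans (ltW (truncnS_gt _)))//.
  by rewrite ler_nat ltnS ltnW// (leq_trans _ k1k)// leq_addl.
have n0 : 0 <= n%:R :> R by [].
have Tn : (T k.+1)%:R <= n%:R :> R by rewrite ler_nat.
set q := k.+1%:R^-1 in kk ke *; set q' := k.+2%:R^-1 in kk *.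
have q0 : 0 <= q by rewrite invr_ge0 ltW.
have : q' * (n%:R + (T k.+1)%:R) <= q * (n%:R + n%:R).
  by rewrite ler_pM ?addr_ge0 ?invr_ge0// lerD2l.
have : m%:R <= q * n%:R.
  rewrite /q ler_pdivlMl// -natrM ler_nat (leq_trans _ kn)// TS; nia.
have : q * (T k.+1)%:R <= q * n%:R by rewrite ler_wpM2l.
have : 6 * q * n%:R <= e * n%:R by rewrite ler_wpM2r.
lra.
Qed.

End concatenation.

Section lifting.
Variables (R : realType) (A B : finType) (b0 : B).

(* Kamae's theorem on lifting generic points to a joining. *)
Lemma exists_lift (P : seq (A * B) -> R) (x : nat -> A) :
  stationary_law P -> (forall a, has_freq x a (fst_law P a)) ->
  exists y : nat -> B, forall w, has_freq (fun i => (x i, y i)) w (P w).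
Proof.
move=> Pl xP.
have q0 k : 0 < k.+1%:R^-1 :> R by rewrite invr_gt0.
have h k := cid (exists_approx_freq Pl b0 xP k (q0 k)).
pose Y k := projT1 (h k); have YP k := projT2 (h k); rewrite -/(Y _) in YP.
have P01 w : 0 <= P w <= 1 by rewrite law_le1// andbT; case: Pl.
have [kap hkap] := exists_diagonal_freq P01 YP.
by exists (fun i => Y (kap i) i).
Qed.

End lifting.

(** * Measures on sequence spaces *)

Section cylinders.

Definition cyl (C : eqType) (w : seq C) : set (nat -> C) :=
  [set z | block z 0 (size w) = w].

Lemma cyl_nil (C : eqType) : cyl [::] = [set: nat -> C].
Proof. exact/seteqP. Qed.

Lemma block_rcons (C : Type) (z : nat -> C) i m :
  block z i m.+1 = rcons (block z i m) (z (i + m)%N).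
Proof. by rewrite /block /mkseq -addn1 iotaD map_cat cats1. Qed.

Lemma block_cons (C : Type) (z : nat -> C) i m :
  block z i m.+1 = z i :: block z i.+1 m.
Proof.
rewrite /block /mkseq/= addn0; congr cons.
by rewrite -[1%N]addn0 iotaDl -map_comp; apply: eq_map => j /=; rewrite addnA addn1.
Qed.

Lemma cyl_rcons (C : eqType) (w : seq C) c :
  cyl (rcons w c) = cyl w `&` [set z | z (size w) = c].
Proof.
apply/seteqP; split => z; rewrite /cyl/= size_rcons block_rcons add0n.
  by move=> /rcons_inj[].
by move=> [-> ->].
Qed.

Lemma cyl_cons (C : eqType) (w : seq C) c :
  cyl (c :: w) = [set z | z 0%N = c] `&` @left_shift C @^-1` cyl w.
Proof.
apply/seteqP; split => z; rewrite /cyl/= block_cons.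
  by move=> [].
by move=> [-> zw]; congr cons.
Qed.

(** Two cylinders are nested or disjoint; with the empty set they are closed under intersection. *)
Lemma cylI (C : eqType) (v w : seq C) : (size v <= size w)%N ->
  cyl v `&` cyl w = if take (size v) w == v then cyl w else set0.
Proof.
move=> vw; have wE z : cyl w z -> block z 0 (size v) = take (size v) w.
  by move=> wz; rewrite -{1}wz -(@take_drop_block _ z 0 (size w) 0)// drop0 wz.
case: eqP => [vE|nvE]; apply/seteqP; split => z //=.
- by case.
- by move=> wz; split => //; rewrite /cyl /= wE.
- by move=> [vz /wE]; rewrite vz => /esym.
Qed.

Lemma cylinderE (A : eqType) m (B : m.-tuple A) : cylinder B = cyl B.
Proof.
apply/seteqP; split => z; rewrite /cylinder /cyl/= size_tuple => zB.
  apply: (@eq_from_nth _ (z 0%N)); rewrite size_block ?size_tuple// => i im.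
  by rewrite nth_mkseq// add0n (zB (Ordinal im)) (tnth_nth (z 0%N)).
by move=> j; rewrite (tnth_nth (z 0%N)) -zB nth_mkseq.
Qed.

End cylinders.

(** * Measurable codings by sequences *)

Section coding.

(* The maps [Z _ i] generate the sigma-algebra; this covers both [A^N] and the
   product of two such spaces, seen as [(A * B)^N]. *)
Definition coding d (T : measurableType d) (C : finType) (Z : T -> nat -> C) :=
  (forall i c, measurable [set t | Z t i = c]) /\
  measurable `<=` <<s [set Z @^-1` cyl w | w in [set: seq C]] >>.

Variables (d : measure_display) (T : measurableType d) (C : finType).
Variables (Z : T -> nat -> C) (cZ : coding Z).

Lemma measurable_cyl w : measurable (Z @^-1` cyl w).
Proof.
elim/last_ind: w => [|w c IH]; first by rewrite cyl_nil ?preimage_setT.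
rewrite cyl_rcons preimage_setI; apply: measurableI; first exact: IH.
exact: (cZ.1 (size w) c).
Qed.

Lemma measurable_fun_coding d' (T' : measurableType d') (f : T' -> T) :
  (forall i c, measurable [set t | Z (f t) i = c]) -> measurable_fun setT f.
Proof.
move=> mf; apply: (@measurability _ _ _ _ setT f [set Z @^-1` cyl w | w in setT]).
  apply/seteqP; split; first exact: cZ.2.
  apply: smallest_sub; first exact: sigma_algebra_measurable.
  by move=> _ [w _ <-]; exact: measurable_cyl.
move=> _ [_ [w _ <-] <-]; rewrite setTI.
elim/last_ind: w => [|w c IH]; first by rewrite cyl_nil ?preimage_setT.
rewrite cyl_rcons !preimage_setI; apply: measurableI; first exact: IH.
exact: (mf (size w) c).
Qed.

Variable R : realType.

(** Uniqueness of measures on a generating class closed under intersection; the empty set is added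
    to the cylinders for this closure. *)
Lemma coding_unique (m1 m2 : probability T R) :
  (forall w, m1 (Z @^-1` cyl w) = m2 (Z @^-1` cyl w)) ->
  forall E, measurable E -> m1 E = m2 E.
Proof.
move=> m12; pose G := [set Z @^-1` cyl w | w in [set: seq C]] `|` [set set0].
apply: (measure_unique G (fun=> setT)).
- apply/seteqP; split.
    apply: subset_trans cZ.2 _; by apply: sub_sigma_algebra2 => E GE; left.
  apply: smallest_sub; first exact: sigma_algebra_measurable.
  by move=> _ [[w _ <-]|->]; [exact: measurable_cyl|exact: measurable0].
- move=> _ _ [[v _ <-]|->] [[w _ <-]|->]; rewrite ?set0I ?setI0; try by right.
  have [vw|/ltnW wv] := leqP (size v) (size w).
    rewrite -preimage_setI cylI//; case: eqP => _; [left; by exists w|right].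
    by rewrite preimage_set0.
  rewrite setIC -preimage_setI cylI//; case: eqP => _; [left; by exists v|right].
  by rewrite preimage_set0.
- by move=> _; left; exists [::] => //; rewrite cyl_nil.
- by rewrite bigcup_const.
- by move=> _ [[w _ <-]|->]; [exact: m12|rewrite !measure0].
- by move=> _; rewrite /= probability_setT ltry.
Qed.

Definition coded_law (m : probability T R) (w : seq C) : R :=
  fine (m (Z @^-1` cyl w)).

Lemma coded_lawE (m : probability T R) w : m (Z @^-1` cyl w) = (coded_law m w)%:E.
Proof. by rewrite /coded_law fineK// fin_num_measure//; exact: measurable_cyl. Qed.

Lemma probability_partition (m : probability T R) (F : finType) (h : T -> F) E :
  (forall c, measurable [set t | h t = c]) -> measurable E ->
  fine (m E) = \sum_c fine (m (E `&` [set t | h t = c])).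
Proof.
move=> mh mE; rewrite sum_fine; last first.
  by move=> c _; rewrite fin_num_measure//; exact: measurableI.
congr fine; rewrite fsbig_seq ?index_enum_uniq//.
rewrite -measure_fin_bigcup//; first last.
- by move=> c _; exact: measurableI.
- by move=> c c' _ _ [t [[_ <-] [_ <-]]].
congr (m _); apply/seteqP; split => [t Et|t [c _ []]//].
by exists (h t) => //=; rewrite mem_index_enum.
Qed.

Lemma coded_law_stationary (m : probability T R) (S : T -> T) :
  (forall t, Z (S t) = @left_shift C (Z t)) -> invariant_measure m S ->
  stationary_law (coded_law m).
Proof.
move=> ZS mS; split => [|w|w|w]; rewrite /coded_law.
- by rewrite cyl_nil preimage_setT probability_setT.
- exact: fine_ge0.
- rewrite (@probability_partition _ _ (fun t => Z t (size w))); first last.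
  + exact: measurable_cyl.
  + by move=> c; exact: cZ.1.
  by apply: eq_bigr => c _; rewrite cyl_rcons.
- rewrite -mS; last exact: measurable_cyl.
  have SE : S @^-1` (Z @^-1` cyl w) = Z @^-1` (@left_shift C @^-1` cyl w).
    by apply/seteqP; split => t; rewrite /preimage/= ZS.
  rewrite (@probability_partition _ _ (fun t => Z t 0%N)); first last.
  + rewrite -[X in measurable X]setTI; apply: measurable_fun_coding => //.
      by move=> i c; under eq_set do rewrite ZS; exact: cZ.1.
    exact: measurable_cyl.
  + by move=> c; exact: cZ.1.
  by apply: eq_bigr => c _; rewrite SE cyl_cons setIC.
Qed.

(** The image of [m] under [S] is compared with [m] on cylinders, where left consistency of the law
    gives equality. *)
Lemma stationary_law_invariant (m : probability T R) (S : T -> T) :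
  (forall t, Z (S t) = @left_shift C (Z t)) -> stationary_law (coded_law m) ->
  invariant_measure m S.
Proof.
move=> ZS ml E mE.
have mSf : measurable_fun setT S.
  apply: measurable_fun_coding => i c.
  by under eq_set do rewrite ZS; exact: cZ.1.
pose S' : {mfun T >-> T} := HB.pack S (isMeasurableFun.Build _ _ _ _ S mSf).
rewrite -[LHS]/(distribution m S' E); apply: coding_unique mE => w.
rewrite (coded_lawE m); change (m (S @^-1` (Z @^-1` cyl w)) = (coded_law m w)%:E).
have SE : S @^-1` (Z @^-1` cyl w) = Z @^-1` (@left_shift C @^-1` cyl w).
  by apply/seteqP; split => t; rewrite /preimage/= ZS.
have mSw : measurable (S @^-1` (Z @^-1` cyl w)).
  by rewrite -[X in measurable X]setTI; apply: (mSf measurableT); exact: measurable_cyl.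
rewrite -[LHS]fineK ?fin_num_measure//; congr EFin.
rewrite (@probability_partition _ _ (fun t => Z t 0%N))//; last first.
  by move=> c; exact: cZ.1.
case: ml => _ _ _ ->; apply: eq_bigr => c _.
by rewrite SE /coded_law cyl_cons setIC.
Qed.

End coding.

(** * The shift space and its square are coded *)

Section shift_space_coding.
Variables (A : finType) (a0 : A).

(** Otherwise points outside [U] agreeing with [z] on longer and longer prefixes would converge to
    [z]. *)
Lemma nbhs_cyl (U : set (seq_topology a0)) z : open U -> U z ->
  exists n, cyl (block z 0 n) `<=` U.
Proof.
move=> oU Uz; apply: contrapT => /forallNP h.
have h' n : exists v, cyl (block z 0 n) v /\ ~ U v.
  apply: contrapT => /forallNP g; apply: (h n) => v cv.
  by apply: contrapT => nU; exact: (g v).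
pose v n : seq_topology a0 := projT1 (cid (h' n)).
have vz : v @ \oo --> (z : seq_topology a0).
  apply/cvg_sup => i; apply/cvg_image.
    by apply/seteqP; split => // a _; exists (fun=> a).
  move=> W /nbhs_singleton Wz; exists [set u | W (u i)]; last first.
    by apply/seteqP; split => [_ [u /= Wu <-]//|c Wc]; exists (fun=> c).
  exists i.+1 => // n /= ni; have [vn _] := projT2 (cid (h' n)).
  suff -> : v n i = z i by [].
  have := congr1 (fun s => nth (z i) s i) vn.
  by rewrite /= size_block !nth_mkseq// !add0n.
have /vz : nbhs (z : seq_topology a0) U by exact: open_nbhs_nbhs.
move=> [N _ /(_ N (leqnn N))] /=.
by have [_] := projT2 (cid (h' N)).
Qed.

Lemma open_coord i c : open [set x : seq_topology a0 | x i = c].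
Proof.
pose p : seq_topology a0 -> discrete_topology A := @proj nat (fun=> discrete_topology A) i.
suff : open (p @^-1` [set (c : discrete_topology A)]) by [].
  by apply: open_comp => [? _|]; [exact: proj_continuous|exact: discrete_open].
Qed.

(** Every open set is a union of cylinders, and there are only countably many words. *)
Lemma coding_shift_space : @coding _ (shift_space a0) A (fun x => x).
Proof.
split => [i c|]; first by apply: sub_sigma_algebra; exact: open_coord.
apply: smallest_sub; first exact: smallest_sigma_algebra.
move=> U oU; have -> : U = \bigcup_(w in [set w | cyl w `<=` U]) cyl w.
  apply/seteqP; split => [z Uz|z [w wU wz]]; last exact: wU.
  have [n nU] := nbhs_cyl oU Uz; exists (block z 0 n) => //.
  by rewrite /cyl/= size_block.
set G := (X in <<s X >>); rewrite bigcup_mkcond.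
apply: (@countable_bigcupT_measurable _ (g_sigma_algebraType G)).
  exact: countableP.
move=> w; case: ifP => _; last exact: measurable0.
by apply: sub_sigma_algebra; exists w.
Qed.

Lemma coding_pair : @coding _ (shift_space a0 * shift_space a0)%type (A * A)%type
  (fun z i => (z.1 i, z.2 i)).
Proof.
pose Z (z : shift_space a0 * shift_space a0) i := (z.1 i, z.2 i).
have [mi sub] := coding_shift_space.
have m1 i c : measurable [set z : shift_space a0 * shift_space a0 | z.1 i = c].
  rewrite -[X in measurable X]setTI.
  exact: (@measurable_fst _ _ _ _ measurableT _ (mi i c)).
have m2 i c : measurable [set z : shift_space a0 * shift_space a0 | z.2 i = c].
  rewrite -[X in measurable X]setTI.
  exact: (@measurable_snd _ _ _ _ measurableT _ (mi i c)).
split => [i [a b]|].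
  rewrite [X in measurable X](_ : _ = [set z | z.1 i = a] `&` [set z | z.2 i = b]).
    exact: measurableI.
  by apply/seteqP; split => z /= [-> ->].
set G := (X in <<s X >>).
(* [T'] carries the sigma-algebra generated by the cylinders of pairs. Both projections from it are
   measurable, so it contains the product sigma-algebra. *)
pose T' := g_sigma_algebraType G.
have mZ w : @measurable _ T' (Z @^-1` cyl w).
  by apply: sub_sigma_algebra; exists w.
have mZi i c : @measurable _ T' [set z | Z z i = c].
  rewrite [X in measurable X](_ : _ =
    \bigcup_(w in [set w | size w = i]) (Z @^-1` cyl (rcons w c))).
    rewrite bigcup_mkcond; apply: countable_bigcupT_measurable; first exact: countableP.
    by move=> w; case: ifP => _; [exact: mZ|exact: measurable0].
  apply/seteqP; split => [z /= zc|z [w /= <-]].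
    exists (block (Z z) 0 i); first by rewrite /= size_block.
    by rewrite /preimage/= cyl_rcons; split; rewrite /cyl/= size_block.
  by rewrite /preimage/= cyl_rcons => -[_].
have mf1 : @measurable_fun _ _ T' (shift_space a0) setT fst.
  apply: (measurable_fun_coding coding_shift_space) => i a.
  rewrite [X in measurable X](_ : _ = \bigcup_b [set z | Z z i = (a, b)]).
    by apply: countable_bigcupT_measurable; [exact: countableP|move=> b; exact: mZi].
  by apply/seteqP; split => [z /= za|z [b _ /= [za _]]//]; exists (z.2 i); rewrite // /Z/= za.
have mf2 : @measurable_fun _ _ T' (shift_space a0) setT snd.
  apply: (measurable_fun_coding coding_shift_space) => i b.
  rewrite [X in measurable X](_ : _ = \bigcup_a [set z | Z z i = (a, b)]).
    by apply: countable_bigcupT_measurable; [exact: countableP|move=> a; exact: mZi].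
  by apply/seteqP; split => [z /= zb|z [a _ /= [_ zb]]//]; exists (z.1 i); rewrite // /Z/= zb.
apply: smallest_sub; first exact: smallest_sigma_algebra.
move=> E [] [F mF <-]; rewrite setTI.
- by have := mf1 measurableT F mF; rewrite setTI.
- by have := mf2 measurableT F mF; rewrite setTI.
Qed.

End shift_space_coding.

(** * Nested intervals indexed by words *)

Section interval_coding.
Variables (R : realType) (C : finType).

(** Cumulative sums of [p], the letters being ordered by [enum_rank]. *)
Definition below (p : C -> R) (k : nat) : R := \sum_(c | (enum_rank c < k)%N) p c.

Lemma belowS (p : C -> R) c : below p (enum_rank c).+1 = below p (enum_rank c) + p c.
Proof.
rewrite /below (bigD1 c) ?ltnSn//= addrC; congr (_ + _).
apply: eq_bigl => c'; rewrite ltnS leq_eqVlt.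
have -> : (enum_rank c' == enum_rank c :> nat) = (c' == c).
  by rewrite val_eqE (inj_eq enum_rank_inj).
by case: eqP => [->|]; rewrite ?ltnn ?andbF ?andbT.
Qed.

Lemma below_le (p : C -> R) k l : (forall c, 0 <= p c) -> (k <= l)%N ->
  below p k <= below p l.
Proof.
move=> p0 kl; rewrite /below [leRHS](bigID (fun c => (enum_rank c < k)%N))/=.
rewrite [X in _ <= X + _](eq_bigl (fun c => (enum_rank c < k)%N)) => [|c]; last first.
  by apply: andb_idl => ck; exact: leq_trans kl.
by rewrite lerDl; exact: sumr_ge0.
Qed.

Lemma exists_below (p : C -> R) s : 0 <= s < \sum_c p c ->
  exists c, below p (enum_rank c) <= s < below p (enum_rank c) + p c.
Proof.
move=> /andP[s0 sp].
have pT k : (#|C| <= k)%N -> below p k = \sum_c p c.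
  by move=> Ck; apply: eq_bigl => c; rewrite (leq_trans (ltn_ord _)).
have ex : exists k, below p k <= s by exists 0%N; rewrite /below big_pred0.
have bd k : below p k <= s -> (k <= #|C|)%N.
  by move=> ks; rewrite leqNgt; apply/negP => /ltnW/pT pk; rewrite pk leNgt sp in ks.
case: (ex_maxnP ex bd) => k ks kmax.
have kC : (k < #|C|)%N.
  by rewrite ltnNge; apply/negP => /pT pk; rewrite pk leNgt sp in ks.
exists (enum_val (Ordinal kC)); rewrite -belowS enum_valK ks/= ltNge.
by apply/negP => /kmax; rewrite ltnn.
Qed.

Variable P : seq C -> R.
Hypotheses (P_nil : P [::] = 1) (P_ge0 : forall w, 0 <= P w)
  (P_rcons : forall w, P w = \sum_c P (rcons w c)).

(* The words of length [n] cut [0, 1[ into intervals of lengths [P w], those of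
   length [n.+1] refining those of length [n]. *)
Fixpoint rev_left (s : seq C) : R := if s is c :: s' then
  rev_left s' + below (fun c => P (rcons (rev s') c)) (enum_rank c) else 0.

Definition word_itv (w : seq C) : set R :=
  [set t | rev_left (rev w) <= t < rev_left (rev w) + P w].

Lemma rev_left_rcons w c : rev_left (rev (rcons w c)) =
  rev_left (rev w) + below (fun c => P (rcons w c)) (enum_rank c).
Proof. by rewrite rev_rcons/= revK. Qed.

Lemma word_itv_nil : word_itv [::] = [set t | 0 <= t < 1].
Proof. by rewrite /word_itv/= P_nil add0r. Qed.

Lemma word_itv_rcons w c : word_itv (rcons w c) `<=` word_itv w.
Proof.
move=> t /=; rewrite /word_itv/= rev_left_rcons => /andP[t1 t2].
set p := fun c => _ in t1 t2.
have p0 c' : 0 <= p c' by exact: P_ge0.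
have b0 : 0 <= below p (enum_rank c) by exact: sumr_ge0.
have b1 : below p (enum_rank c) + P (rcons w c) <= P w.
  rewrite -[P (rcons w c)]/(p c) -belowS P_rcons.
  rewrite [leRHS](bigID (fun c' => (enum_rank c' < (enum_rank c).+1)%N))/= lerDl.
  exact: sumr_ge0.
by apply/andP; split; lra.
Qed.

Lemma word_itv_split w t : word_itv w t -> exists c, word_itv (rcons w c) t.
Proof.
move=> /= /andP[t1 t2].
have [|c /andP[c1 c2]] := @exists_below (fun c => P (rcons w c)) (t - rev_left (rev w)).
  by rewrite -P_rcons; apply/andP; split; lra.
by exists c; rewrite /word_itv/= rev_left_rcons; apply/andP; split; lra.
Qed.

(** Prefixes agree by induction; after a common prefix, the intervals of two distinct letters cannot
    overlap because [below] is monotone. *)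
Lemma word_itv_inj v w t : size v = size w -> word_itv v t -> word_itv w t -> v = w.
Proof.
elim/last_ind: v w => [|v c IH] w; first by case: w.
case/lastP: w => [|w c']; rewrite !size_rcons// => -[svw] vt wt.
have vw : v = w.
  by apply: IH => //; [exact: word_itv_rcons vt|exact: word_itv_rcons wt].
move: vt wt; rewrite vw /word_itv/= !rev_left_rcons.
set p := fun c => _ => /andP[c1 c2] /andP[d1 d2].
have p0 a : 0 <= p a by exact: P_ge0.
rewrite -[P (rcons w c)]/(p c) in c2; rewrite -[P (rcons w c')]/(p c') in d2.
congr rcons; apply/enum_rank_inj/val_inj/eqP; rewrite /= eqn_leq; apply/andP.
split; rewrite leqNgt; apply/negP => /(below_le p0); rewrite belowS; lra.
Qed.

Lemma exists_word_itv n t : 0 <= t < 1 -> exists2 w, size w = n & word_itv w t.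
Proof.
move=> t01; elim: n => [|n [w wn wt]]; first by exists [::]; rewrite ?word_itv_nil.
have [c ct] := word_itv_split wt.
by exists (rcons w c); rewrite ?size_rcons ?wn.
Qed.

Lemma exists_interval_coding (c0 : C) : exists z : R -> nat -> C,
  forall t w, 0 <= t < 1 -> block (z t) 0 (size w) = w <-> word_itv w t.
Proof.
have h n t : exists w, 0 <= t < 1 -> size w = n /\ word_itv w t.
  have [/(exists_word_itv n)[w wn wt]|] := boolP (0 <= t < 1).
    by exists w.
  by exists [::].
pose wd n t := projT1 (cid (h n t)).
have wdP n t : 0 <= t < 1 -> size (wd n t) = n /\ word_itv (wd n t) t :=
  projT2 (cid (h n t)).
(* Letter [i] is the last letter of the word of length [i.+1] whose interval contains [t]; by
   nesting and disjointness these words extend one another. *)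
exists (fun t i => nth c0 (wd i.+1 t) i) => t w t01; set z := fun i => _.
have zwd n : block z 0 n = wd n t.
  elim: n => [|n IH]; first by have [/size0nil -> _] := wdP 0%N t t01.
  rewrite block_rcons IH add0n /z; have [] := wdP n.+1 t t01.
  case/lastP: (wd n.+1 t) => // v c; rewrite size_rcons => -[vn] vt.
  have [wn wt] := wdP n t t01.
  rewrite nth_rcons vn ltnn eqxx; congr rcons.
  by apply: (@word_itv_inj _ _ t) => //; [rewrite vn|exact: word_itv_rcons vt].
have [ws wt] := wdP (size w) t t01.
rewrite zwd; split => [<-//|ww].
exact: (@word_itv_inj _ _ t).
Qed.

End interval_coding.

(** * Realizing a stationary law by a measure *)

Section exists_coded_law.
Variables (R : realType) (d : measure_display) (T : measurableType d) (C : finType).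
Variables (Z : T -> nat -> C) (cZ : coding Z) (dec : (nat -> C) -> T).
Hypothesis decK : forall z, Z (dec z) = z.

(** The measure is the image of Lebesgue measure on [[0, 1[] under the interval coding, the interval
    of [w] having length [P w]. *)
Lemma exists_coded_law (P : seq C -> R) (c0 : C) : stationary_law P ->
  exists m : probability T R, forall w, coded_law Z m w = P w.
Proof.
move=> [Pn P0 Pr _].
have [z zP] := exists_interval_coding Pn P0 Pr c0.
pose D : set R := `[0, 1[%classic.
have DE t : D t = (0 <= t < 1) by rewrite /D/= in_itv.
have itvE w : word_itv P w =
    `[rev_left P (rev w), rev_left P (rev w) + P w[%classic.
  by apply/seteqP; split => t; rewrite /word_itv/= in_itv.
have itvD w : word_itv P w `<=` D.
  elim/last_ind: w => [|w c IH]; first by rewrite word_itv_nil// => t; rewrite DE.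
  by apply: subset_trans IH; exact: word_itv_rcons.
have mitv w : measurable (word_itv P w) by rewrite itvE; exact: measurable_itv.
(* The coding is only controlled on [[0, 1[]; a constant sequence elsewhere makes [x] measurable on
   the whole line. *)
pose x t := if (0 <= t < 1) then z t else (fun=> c0).
have xcyl w : [set t | cyl w (x t)] `&` D = word_itv P w.
  apply/seteqP; split => [t [/= xt]|t wt].
    by rewrite DE => t01; rewrite /x t01 in xt; apply/zP.
  have := itvD w t wt; rewrite DE => t01; split; last by rewrite DE.
  by rewrite /= /x t01 /cyl /=; apply/zP.
have mD : measurable D by exact: measurable_itv.
have mx i c : measurable [set t | x t i = c].
  have mxi : measurable (\bigcup_(w in [set w | size w = i]) word_itv P (rcons w c)).
    rewrite bigcup_mkcond; apply: countable_bigcupT_measurable; first exact: countableP.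
    by move=> w; case: ifP => _; [exact: mitv|exact: measurable0].
  have xDE : [set t | x t i = c] `&` D =
      \bigcup_(w in [set w | size w = i]) word_itv P (rcons w c).
    apply/seteqP; split => [t [/= xt Dt]|t [w /= wi]]; last first.
      rewrite -xcyl cyl_rcons => -[[_ /=]]; rewrite wi => xt Dt.
      by split.
    exists (block (x t) 0 i); first by rewrite /= size_block.
    by rewrite -xcyl cyl_rcons; split => //; split; rewrite /cyl/= size_block.
  rewrite -(setUIDK [set t | x t i = c] D) xDE; apply: measurableU => //.
  have -> : [set t | x t i = c] `\` D = if c0 == c then ~` D else set0.
    apply/seteqP; split => t.
      by move=> [/= xt Dt]; move: xt; rewrite /x; case: ifPn => [|_ ->];
        rewrite -?DE// eqxx.
    case: eqP => // <- Dt; split => //=; rewrite /x.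
    by case: ifPn => // t01; exfalso; apply: Dt; rewrite DE.
  by case: ifP => _; [exact: measurableC|exact: measurable0].
pose RT := measurableTypeR R.
have mDT : @measurable _ RT D by [].
pose U := @mrestr _ RT R D lebesgue_measure mDT.
have U1 : U setT = 1%:E.
  by rewrite /U/= /mrestr setTI lebesgue_measure_itv/= lte01 sube0.
pose U' : probability RT R := HB.pack U (Measure_isProbability.Build _ _ _ U U1).
pose f : RT -> T := dec \o x.
have fE t : Z (f t) = x t by exact: decK.
have mf : measurable_fun setT f.
  apply: (measurable_fun_coding cZ) => i c.
  have -> : [set t | Z (f t) i = c] = [set t | x t i = c].
    by apply/seteqP; split => t /=; rewrite fE.
  exact: mx.
pose f' : {mfun RT >-> T} := HB.pack f (isMeasurableFun.Build _ _ _ _ f mf).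
exists (distribution U' f') => w.
suff h : lebesgue_measure ((f @^-1` (Z @^-1` cyl w)) `&` D) = (P w)%:E.
  exact: (congr1 fine h).
have -> : f @^-1` (Z @^-1` cyl w) = [set t | cyl w (x t)].
  by apply/seteqP; split => t /=; rewrite fE.
rewrite xcyl itvE lebesgue_measure_itv/= lte_fin ltrDl.
rewrite -EFinB addrAC subrr add0r.
(* A degenerate interval has measure 0, and then [P w = 0] by nonnegativity. *)
by case: ltP => // ?; congr EFin; apply/eqP; rewrite eq_le P0.
Qed.

End exists_coded_law.

(** * Correlations *)

Section frequencies.
Variable R : realType.

Definition freq (C : eqType) (z : nat -> C) (w : seq C) (n : nat) : R :=
  (occ z w n)%:R / n%:R.

Lemma freq01 (C : eqType) (z : nat -> C) w n : 0 <= freq z w n <= 1.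
Proof.
rewrite /freq divr_ge0//=; case: n => [|n]; first by rewrite invr0 mulr0.
by rewrite ler_pdivrMr ?ltr0n// mul1r ler_nat occ_leq.
Qed.

Lemma occurrencesE (A : finType) (x : nat -> A) m (B : m.-tuple A) n :
  occurrences x B n = occ x B n.
Proof.
rewrite /occurrences /occ -sum1_card big_mkcond/= size_tuple.
apply: eq_bigr => i _; rewrite inE -[LHS]/(nat_of_bool _).
have -> : [forall j : 'I_m, x (i + j)%N == tnth B j] = (block x i m == B) => //.
apply/forallP/eqP => [h|h j]; last first.
  by rewrite (tnth_nth (x 0%N)) -h nth_mkseq.
apply: (@eq_from_nth _ (x 0%N)); rewrite size_block ?size_tuple// => j jm.
by rewrite nth_mkseq// (eqP (h (Ordinal jm))) (tnth_nth (x 0%N)).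
Qed.

Lemma freq_nil (C : eqType) (z : nat -> C) : freq z [::] @ \oo --> (1 : R).
Proof.
apply: (@cvg_trans _ ((fun=> 1 : R) @ \oo)); last exact: cvg_cst.
apply: near_eq_cvg; exists 1%N => // n /= n0.
by rewrite /freq /occ sum_nat_const card_ord muln1 divff// pnatr_eq0 -lt0n.
Qed.

Lemma has_freqP (C : eqType) (z : nat -> C) (w : seq C) (p : R) :
  has_freq z w p <-> freq z w @ \oo --> p.
Proof.
have E n : (0 < n)%N -> `|(occ z w n)%:R - p * n%:R| = `|p - freq z w n| * n%:R.
  move=> n0; have n0' : n%:R != 0 :> R by rewrite pnatr_eq0 -lt0n.
  by rewrite distrC -[n%:R in RHS](normr_nat R n) -normrM mulrBl /freq divfK.
split => [h|/cvgrPdist_le h e e0].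
  apply/cvgrPdist_le => e e0; have [N hN] := h e e0; exists (maxn N 1) => // n /=.
  rewrite geq_max => /andP[Nn n0]; have := hN n Nn.
  by rewrite E// ler_pM2r// ltr0n.
have [N _ hN] := h e e0; exists N => n Nn.
case: n => [|n] in Nn *; first by rewrite /occ big_ord0 !mulr0 subrr normr0.
by rewrite E// ler_wpM2r//; exact: hN.
Qed.

Lemma generic_freqP (A : finType) (a0 : A) (x : nat -> A)
    (mu : probability (shift_space a0) R) : generic x mu <->
  forall w, freq x w @ \oo --> coded_law (fun x : shift_space a0 => x) mu w.
Proof.
split => [xmu w|h m B m0].
  have [->|w0] := eqVneq w [::].
    by rewrite /coded_law cyl_nil preimage_setT probability_setT; exact: freq_nil.
  have := xmu _ (in_tuple w); rewrite lt0n size_eq0 => /(_ w0).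
  rewrite cylinderE /freq; apply: cvg_trans; apply: near_eq_cvg.
  by apply: nearW => n; rewrite occurrencesE.
rewrite cylinderE; apply: cvg_trans (h B); apply: near_eq_cvg.
by apply: nearW => n; rewrite occurrencesE.
Qed.

Lemma cvg_sum_fin (I : finType) (T : Type) (F : set_system T) (f : I -> T -> R) l :
  Filter F -> (forall i, f i @ F --> l i) ->
  (fun t => \sum_i f i t) @ F --> \sum_i l i.
Proof.
by move=> FF h; apply: (@cvg_big R^o I _ _ _ (@add_continuous R^o)) => // i _; exact: h.
Qed.

Lemma eq_zip (A B : eqType) (u w : seq A) (v b : seq B) :
  size u = size v -> size w = size b -> (zip u v == zip w b) = (u == w) && (v == b).
Proof.
move=> uv wb; apply/eqP/andP => [h|[/eqP-> /eqP->]//].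
split; apply/eqP.
  by rewrite -(unzip1_zip (eq_leq uv)) h unzip1_zip ?wb.
by rewrite -(unzip2_zip (eq_leq (esym uv))) h unzip2_zip ?wb.
Qed.

(** Below each occurrence of [w] in [x] stands exactly one block of [y]. *)
Lemma freq_fst (A B : finType) (x : nat -> A) (y : nat -> B) w n :
  freq x w n = \sum_(b : (size w).-tuple B) freq (fun i => (x i, y i)) (zip w b) n.
Proof.
rewrite /freq -mulr_suml; congr (_ / _); rewrite -natr_sum /occ; congr _%:R.
rewrite exchange_big; apply: eq_bigr => i _.
have E (b : (size w).-tuple B) :
    (block (fun i => (x i, y i)) i (size (zip w b)) == zip w b) =
    (block x i (size w) == w) && (block_tuple y i (size w) == b).
  by rewrite size_zip size_tuple minnn block_pair eq_zip ?size_block ?size_tuple.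
rewrite (bigD1 (block_tuple y i (size w)))//= big1 => [|b bi].
  by rewrite addn0 (E (block_tuple y i (size w))) eqxx andbT.
by rewrite E [block_tuple _ _ _ == _]eq_sym (negPf bi) andbF.
Qed.

Lemma freq_snd (A B : finType) (x : nat -> A) (y : nat -> B) w n :
  freq y w n = \sum_(a : (size w).-tuple A) freq (fun i => (x i, y i)) (zip a w) n.
Proof.
rewrite /freq -mulr_suml; congr (_ / _); rewrite -natr_sum /occ; congr _%:R.
rewrite exchange_big; apply: eq_bigr => i _.
have E (a : (size w).-tuple A) :
    (block (fun i => (x i, y i)) i (size (zip a w)) == zip a w) =
    (block_tuple x i (size w) == a) && (block y i (size w) == w).
  by rewrite size_zip size_tuple minnn block_pair eq_zip ?size_block ?size_tuple.
rewrite (bigD1 (block_tuple x i (size w)))//= big1 => [|a ai].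
  by rewrite addn0 (E (block_tuple x i (size w))) eqxx.
by rewrite E eq_sym (negPf ai).
Qed.

Lemma freq_rcons (C : finType) (z : nat -> C) w n :
  freq z w n = \sum_c freq z (rcons w c) n.
Proof.
rewrite /freq -mulr_suml; congr (_ / _); rewrite -natr_sum /occ; congr _%:R.
rewrite exchange_big; apply: eq_bigr => i _.
rewrite (bigD1 (z (i + size w)%N))//= big1 => [|c ci].
  by rewrite addn0 size_rcons block_rcons eqseq_rcons eqxx andbT.
by rewrite size_rcons block_rcons eqseq_rcons [z _ == _]eq_sym (negPf ci) andbF.
Qed.

(** Occurrences of [w] preceded by some letter are those starting at 1, ..., n instead of 0, ..., n
    - 1; only the two end terms differ. *)
Lemma freq_cons (C : finType) (z : nat -> C) w n :
  `|freq z w n - \sum_c freq z (c :: w) n| <= n%:R^-1.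
Proof.
rewrite /freq -mulr_suml -mulrBl normrM normfV normr_nat.
rewrite -[leRHS]mul1r ler_wpM2r ?invr_ge0//.
rewrite -natr_sum; have -> : (\sum_c occ z (c :: w) n =
    \sum_(i < n) (block z i.+1 (size w) == w))%N.
  rewrite /occ exchange_big; apply: eq_bigr => i _.
  rewrite (bigD1 (z i))//= big1 => [|c ci].
    by rewrite addn0 block_cons eqseq_cons eqxx.
  by rewrite block_cons eqseq_cons eq_sym (negPf ci).
rewrite /occ; set g := fun i => (block z i (size w) == w : nat).
have : (\sum_(i < n) g i + g n = g 0 + \sum_(i < n) g i.+1)%N.
  transitivity (\sum_(i < n.+1) g i)%N; first by rewrite big_ord_recr.
  by rewrite big_ord_recl.
move/(congr1 (fun m => m%:R : R)); rewrite !natrD => h.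
have g01 i : 0 <= ((g i)%:R : R) <= 1 by rewrite ler0n (ler_nat R (g i) 1) leq_b1.
have /andP[? ?] := g01 n; have /andP[? ?] := g01 0%N.
by rewrite ler_norml; apply/andP; split; lra.
Qed.

(** By compactness the image filter has a cluster point, and an ultrafilter converges to each of its
    cluster points. *)
Lemma ultra_lim (T : Type) (G : set_system T) (f : T -> R) : UltraFilter G ->
  (forall t, 0 <= f t <= 1) -> exists l : R, f @ G --> l.
Proof.
move=> GU f01; have PG : ProperFilter G by exact: ultra_proper.
have [|p [_ fp]] := @segment_compact R 0 1 (f @ G) (fmap_proper_filter f PG).
  suff : G (f @^-1` `[0, 1]) by [].
  by apply: filterE => t /=; rewrite in_itv/= f01.
exists p => B pB.
have [//|GB] := in_ultra_setVsetC (f @^-1` B) GU.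
by have [q []] := fp (~` B) B GB pB.
Qed.

End frequencies.

(** * Limit laws along an ultrafilter *)

Section limit_law.
Variables (R : realType) (C : finType) (z : nat -> C) (G : set_system nat).
Hypotheses (GU : UltraFilter G) (GG : \oo `<=` G).

(** Right consistency holds for the frequencies at every [n]; left consistency only up to [n%:R^-1],
    which vanishes along [G] because [G] contains the cofinite sets. *)
Lemma exists_limit_law : exists P : seq C -> R,
  stationary_law P /\ forall w, freq R z w @ G --> P w.
Proof.
have PG : ProperFilter G by exact: ultra_proper.
have oo_cvg (f : nat -> R) l : f @ \oo --> l -> f @ G --> l.
  by move=> fl B /fl; exact: GG.
have h w := cid (ultra_lim GU (freq01 R z w)).
pose P w : R := projT1 (h w); have PE w : freq R z w @ G --> P w := projT2 (h w).
exists P; split => //; split.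
- apply: (@cvg_unique R^o (@Rhausdorff R) _ _ _ _ (PE [::])).
  by apply: oo_cvg; exact: freq_nil.
- move=> w; apply: (@closed_cvg _ R^o G _ _ (fun t => 0 <= t)) (PE w).
    exact: closed_ge.
  by apply: nearW => n; have /andP[] := freq01 R z w n.
- move=> w; apply: (@cvg_unique R^o (@Rhausdorff R) _ _ _ _ (PE w)).
  have -> : freq R z w = (fun n => \sum_c freq R z (rcons w c) n).
    by apply/funext => n; exact: freq_rcons.
  by apply: cvg_sum_fin => c; exact: PE.
- move=> w; apply: (@cvg_unique R^o (@Rhausdorff R) _ _ _ _ (PE w)).
  pose e n := freq R z w n - \sum_c freq R z (c :: w) n.
  have e0 : e @ G --> (0 : R).
    have n0 : (fun n => n%:R^-1 : R) @ \oo --> (0 : R).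
      by rewrite -(cvg_shiftS (fun n => n%:R^-1 : R)); exact: cvg_harmonic.
    apply: oo_cvg; apply/norm_cvg0P; apply: (squeeze_cvgr _ (cvg_cst 0) n0).
    by apply: nearW => n; rewrite normr_ge0 freq_cons.
  have -> : freq R z w = (fun n => e n + \sum_c freq R z (c :: w) n).
    by apply/funext => n; rewrite /e subrK.
  rewrite -[\sum_c P (c :: w)]add0r; apply: cvgD => //.
  by apply: cvg_sum_fin => c; exact: PE.
Qed.

End limit_law.

(** * Marginals of a law on pairs *)

Section pair_law.
Variables (R : realType) (A : finType) (a0 : A).
Variable m : probability (shift_space a0 * shift_space a0)%type R.

Definition pair_seq (z : shift_space a0 * shift_space a0) (i : nat) := (z.1 i, z.2 i).

Lemma block_pair_seq z i k : block (pair_seq z) i k = zip (block z.1 i k) (block z.2 i k).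
Proof. exact: block_pair. Qed.

Lemma fst_coded_law w :
  fine (m (fst @^-1` cyl w)) = fst_law (coded_law pair_seq m) w.
Proof.
have mfst := @measurable_fst _ _ (shift_space a0) (shift_space a0).
have msnd := @measurable_snd _ _ (shift_space a0) (shift_space a0).
rewrite (@probability_partition _ _ _ m _ (fun z => block_tuple (z.2 : nat -> A) 0 (size w))).
- apply: eq_bigr => b _; rewrite /coded_law; congr (fine (m _)).
  apply/seteqP; split => z; rewrite /preimage /cyl/= size_zip size_tuple minnn.
    by move=> [zw zb]; rewrite block_pair_seq zw -zb.
  rewrite block_pair_seq => /eqP; rewrite eq_zip ?size_block ?size_tuple//.
  by move=> /andP[/eqP zw /eqP zb]; split => //; exact: val_inj.
- move=> b; have -> : [set z : shift_space a0 * shift_space a0 |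
      block_tuple (z.2 : nat -> A) 0 (size w) = b] = snd @^-1` cyl b.
    apply/seteqP; split => z; rewrite /cyl/= size_tuple => zb; last exact: val_inj.
    by rewrite -zb.
  rewrite -[X in measurable X]setTI; apply: (msnd measurableT).
  exact: (measurable_cyl (coding_shift_space a0)).
- rewrite -[X in measurable X]setTI; apply: (mfst measurableT).
  exact: (measurable_cyl (coding_shift_space a0)).
Qed.

Lemma snd_coded_law w : fine (m (snd @^-1` cyl w)) =
  \sum_(a : (size w).-tuple A) coded_law pair_seq m (zip a w).
Proof.
have mfst := @measurable_fst _ _ (shift_space a0) (shift_space a0).
have msnd := @measurable_snd _ _ (shift_space a0) (shift_space a0).
rewrite (@probability_partition _ _ _ m _ (fun z => block_tuple (z.1 : nat -> A) 0 (size w))).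
- apply: eq_bigr => b _; rewrite /coded_law; congr (fine (m _)).
  apply/seteqP; split => z; rewrite /preimage /cyl/= size_zip size_tuple minnn.
    by move=> [zw zb]; rewrite block_pair_seq zw -zb.
  rewrite block_pair_seq => /eqP; rewrite eq_zip ?size_block ?size_tuple//.
  by move=> /andP[/eqP zb /eqP zw]; split => //; exact: val_inj.
- move=> b; have -> : [set z : shift_space a0 * shift_space a0 |
      block_tuple (z.1 : nat -> A) 0 (size w) = b] = fst @^-1` cyl b.
    apply/seteqP; split => z; rewrite /cyl/= size_tuple => zb; last exact: val_inj.
    by rewrite -zb.
  rewrite -[X in measurable X]setTI; apply: (mfst measurableT).
  exact: (measurable_cyl (coding_shift_space a0)).
- rewrite -[X in measurable X]setTI; apply: (msnd measurableT).
  exact: (measurable_cyl (coding_shift_space a0)).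
Qed.

End pair_law.

(** * Correlation as a function of pair frequencies *)

Section complex_correlation.
Variables (R : realType) (K : finType) (v : K -> R[i]).
Import Normc.

(* The correlation of two sequences over the alphabet [K], embedded in the
   complex numbers by [v], or of two measures, as a function of the frequencies
   [f] of the pairs of letters. *)
Definition pair_corr (f : K * K -> R) : R[i] :=
  \sum_c v c.1 * (v c.2)^* * (f c)%:C%C
  - (\sum_c v c.1 * (f c)%:C%C) * (\sum_c (v c.2)^* * (f c)%:C%C).

Lemma sum_letters (C : finType) (z : nat -> C) (g : C -> R[i]) n :
  n%:R^-1 * \sum_(i < n) g (z i) = \sum_c g c * (freq R z [:: c] n)%:C%C.
Proof.
have -> : \sum_(i < n) g (z i) = \sum_c g c * (occ z [:: c] n)%:R.
  transitivity (\sum_(i < n) \sum_c g c * (z i == c)%:R).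
    apply: eq_bigr => i _; rewrite (bigD1 (z i))//= eqxx mulr1.
    by rewrite big1 ?addr0// => c; rewrite eq_sym => /negPf ->; rewrite mulr0.
  rewrite exchange_big; apply: eq_bigr => c _.
  rewrite -mulr_sumr /occ natr_sum; congr (_ * _).
  by apply: eq_bigr => i _; rewrite block_cons eqseq_cons andbT.
rewrite mulr_sumr; apply: eq_bigr => c _; rewrite mulrCA; congr (_ * _).
by rewrite /freq rmorphM fmorphV !rmorph_nat mulrC.
Qed.

Lemma prefix_corrE (x y : nat -> K) n :
  prefix_corr (fun i => v (x i)) (fun i => v (y i)) n =
  pair_corr (fun c => freq R (fun i => (x i, y i)) [:: c] n).
Proof.
rewrite /prefix_corr /block_corr.
pose z i := (x i, y i).
by rewrite (sum_letters z (fun c => v c.1 * (v c.2)^*)) (sum_letters z (fun c => v c.1))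
  (sum_letters z (fun c => (v c.2)^*)).
Qed.

(** Componentwise convergence reduces complex limits to real ones. *)
Definition complex_cvg (T : Type) (F : set_system T) (u : T -> R[i]) (l : R[i]) :=
  ((fun t => complex.Re (u t)) @ F --> complex.Re l) /\
  ((fun t => complex.Im (u t)) @ F --> complex.Im l).

Section complex_limits.
Variables (T : Type) (F : set_system T) (FF : ProperFilter F).

Lemma complex_cvgB u1 u2 l1 l2 : complex_cvg F u1 l1 -> complex_cvg F u2 l2 ->
  complex_cvg F (fun t => u1 t - u2 t) (l1 - l2).
Proof.
move=> [r1 i1] [r2 i2]; split.
  rewrite raddfB; under eq_fun do rewrite raddfB; exact: cvgB.
rewrite raddfB; under eq_fun do rewrite raddfB; exact: cvgB.
Qed.

Lemma complex_cvgM u1 u2 l1 l2 : complex_cvg F u1 l1 -> complex_cvg F u2 l2 ->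
  complex_cvg F (fun t => u1 t * u2 t) (l1 * l2).
Proof.
have ReM (a b : R[i]) : complex.Re (a * b) =
  complex.Re a * complex.Re b - complex.Im a * complex.Im b by case: a; case: b.
have ImM (a b : R[i]) : complex.Im (a * b) =
  complex.Re a * complex.Im b + complex.Im a * complex.Re b by case: a; case: b.
move=> [r1 i1] [r2 i2]; split.
  rewrite ReM; under eq_fun do rewrite ReM.
  by apply: cvgB; apply: cvgM.
rewrite ImM; under eq_fun do rewrite ImM.
by apply: cvgD; apply: cvgM.
Qed.

Lemma complex_cvg_cst l : complex_cvg F (fun=> l) l.
Proof. by split; exact: cvg_cst. Qed.

Lemma complex_cvg_real (u : T -> R) (l : R) : u @ F --> l ->
  complex_cvg F (fun t => (u t)%:C%C) l%:C%C.
Proof. by move=> ul; split => //=; exact: cvg_cst. Qed.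

Lemma complex_cvg_sum (I : finType) (u : I -> T -> R[i]) l :
  (forall i, complex_cvg F (u i) (l i)) ->
  complex_cvg F (fun t => \sum_i u i t) (\sum_i l i).
Proof.
move=> h; split.
  rewrite raddf_sum; under eq_fun do rewrite raddf_sum.
  by apply: cvg_sum_fin => i; exact: (h i).1.
rewrite raddf_sum; under eq_fun do rewrite raddf_sum.
by apply: cvg_sum_fin => i; exact: (h i).2.
Qed.

Lemma complex_cvg_normc u l : complex_cvg F u l ->
  (fun t => normc (u t)) @ F --> normc l.
Proof.
move=> [ur ui].
have normcE (a : R[i]) : normc a = Num.sqrt (complex.Re a ^+ 2 + complex.Im a ^+ 2).
  by case: a.
rewrite normcE; under eq_fun do rewrite normcE.
apply: continuous_cvg; first exact: sqrt_continuous.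
by rewrite !expr2; under eq_fun do rewrite !expr2; apply: cvgD; apply: cvgM.
Qed.

Lemma pair_corr_cvg (f : T -> K * K -> R) p : (forall c, f ^~ c @ F --> p c) ->
  (fun t => normc (pair_corr (f t))) @ F --> normc (pair_corr p).
Proof.
move=> fp; apply: complex_cvg_normc; apply: complex_cvgB; last apply: complex_cvgM.
- by apply: complex_cvg_sum => c; apply: complex_cvgM;
    [exact: complex_cvg_cst|exact: complex_cvg_real].
- by apply: complex_cvg_sum => c; apply: complex_cvgM;
    [exact: complex_cvg_cst|exact: complex_cvg_real].
- by apply: complex_cvg_sum => c; apply: complex_cvgM;
    [exact: complex_cvg_cst|exact: complex_cvg_real].
Qed.

End complex_limits.

(** Both terms are built from averages of numbers in the unit disc. The bound makes the set of
    joining values bounded above. *)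
Lemma normc_pair_corr_le f : (forall a, `|v a| <= 1) -> (forall c, 0 <= f c) ->
  \sum_c f c = 1 -> normc (pair_corr f) <= 2.
Proof.
move=> v1 f0 f1.
have avg (g : K * K -> R[i]) : (forall c, `|g c| <= 1) ->
    `|\sum_c g c * (f c)%:C%C| <= 1.
  move=> g1; apply: le_trans (ler_norm_sum _ _ _) _.
  apply: (@le_trans _ _ (\sum_c (f c)%:C%C)).
    apply: ler_sum => c _; rewrite normrM (@ger0_norm _ (f c)%:C%C) ?ler0c//.
    by rewrite ler_piMl ?ler0c.
  by rewrite -rmorph_sum/= f1.
have vc a : `|(v a)^*| <= 1 by rewrite norm_conjC.
have : `|pair_corr f| <= 2.
  rewrite /pair_corr; apply: le_trans (ler_normB _ _) _.
  rewrite -[leRHS]/(1 + 1); apply: lerD.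
    by apply: avg => c; rewrite normrM mulr_ile1.
  by rewrite normrM mulr_ile1// avg.
by rewrite -lecR => /le_trans; apply; rewrite rmorph_nat.
Qed.

End complex_correlation.

(** * Integrals of functions with finitely many values *)

Section complex_integrals.
Variables (R : realType) (d : measure_display) (T : measurableType d).
Variables (m : probability T R) (F : finType) (h : T -> F).
Hypothesis mh : forall c, measurable [set t | h t = c].

Lemma Rintegral_finite (g : F -> R) :
  \int[m]_t g (h t) = \sum_c g c * fine (m [set t | h t = c]).
Proof.
have E : (fun t => (g (h t))%:E) =
    (fun t => \sum_c (g c)%:E * (\1_[set t | h t = c] t)%:E)%E.
  apply/funext => t; rewrite (bigD1 (h t))//= indicE mem_set// mule1.
  rewrite big1 ?adde0// => c ch; rewrite indicE memNset ?mule0//.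
  by move=> /= hc; rewrite hc eqxx in ch.
have mi c : m.-integrable setT (fun t => (\1_[set t | h t = c] t)%:E).
  exact: integrable_indic.
rewrite /Rintegral E integral_sum//; last by move=> c; exact: integrableZl.
rewrite -sum_fine; last first.
  by move=> c _; rewrite integralZl// integral_indic// setIT fin_numM// fin_num_measure.
apply: eq_bigr => c _; rewrite integralZl// integral_indic// setIT fineM//.
by rewrite fin_num_measure.
Qed.

Lemma complex_integral_finite (g : F -> R[i]) :
  complex_integral m (fun t => g (h t)) =
  \sum_c g c * (fine (m [set t | h t = c]))%:C%C.
Proof.
apply/eqP; rewrite eq_complex /complex_integral/=.
rewrite (Rintegral_finite (fun c => complex.Re (g c))).
rewrite (Rintegral_finite (fun c => complex.Im (g c))).
rewrite !raddf_sum/=; apply/andP; split; apply/eqP; apply: eq_bigr => c _.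
  by case: (g c) => a b /=; rewrite mulr0 subr0.
by case: (g c) => a b /=; rewrite mulr0 add0r.
Qed.

End complex_integrals.

(** * Joinings and correlated sequences *)

Section measure_correlation.
Variables (R : realType) (K : {fset R[i]}) (k0 : K).
Import Normc.

Lemma coding_pair_seq : coding (@pair_seq K k0).
Proof. exact: coding_pair. Qed.

Lemma sum_tuple1 (C : finType) (F : seq C -> R) :
  \sum_(t : 1.-tuple C) F t = \sum_c F [:: c].
Proof.
rewrite sum_tuple_cons; apply: eq_bigr => c _.
by rewrite (sum_tuple0 (fun s => F (c :: s))).
Qed.

Lemma cyl1 (C : eqType) (c : C) : cyl [:: c] = [set z | z 0%N = c].
Proof.
by apply/seteqP; split => z; rewrite /cyl/= block_cons; [case|move=> ->].
Qed.

(** All three integrals depend on first letters only, and the marginal conditions express the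
    first-letter laws of [mu] and [nu] through [xi]. *)
Lemma joining_corrE (mu nu : probability (shift_space k0) R) xi :
  joining mu nu xi ->
  complex_integral xi (fun z => symbol1 z.1 * (symbol1 z.2)^*)
  - complex_integral mu (@symbol1 R K k0) * complex_integral nu (fun y => (symbol1 y)^*)
  = pair_corr (fun a : K => val a) (fun c => coded_law (@pair_seq K k0) xi [:: c]).
Proof.
move=> [_ xi1 xi2].
have mZ c : measurable [set z : shift_space k0 | z 0%N = c].
  exact: ((coding_shift_space k0).1 0%N c).
have mu1 a : fine (mu [set z | z 0%N = a]) =
    \sum_b coded_law (@pair_seq K k0) xi [:: (a, b)].
  rewrite -xi1// -cyl1 fst_coded_law /fst_law.
  exact: (sum_tuple1 (fun s => coded_law (@pair_seq K k0) xi (zip [:: a] s))).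
have nu1 b : fine (nu [set z | z 0%N = b]) =
    \sum_a coded_law (@pair_seq K k0) xi [:: (a, b)].
  rewrite -xi2// -cyl1 snd_coded_law.
  exact: (sum_tuple1 (fun s => coded_law (@pair_seq K k0) xi (zip s [:: b]))).
rewrite /pair_corr; congr (_ - _ * _).
- rewrite (complex_integral_finite (h := fun z => pair_seq z 0%N) xi (coding_pair_seq.1 0%N)
    (fun c : K * K => val c.1 * (val c.2)^*)).
  by apply: eq_bigr => c _; rewrite /coded_law cyl1.
- rewrite (complex_integral_finite (h := fun z : shift_space k0 => z 0%N) mu mZ
    (fun a => val a)).
  under eq_bigr do rewrite mu1 rmorph_sum mulr_sumr.
  by rewrite pair_big; apply: eq_bigr => -[a b] _.
- rewrite (complex_integral_finite (h := fun z : shift_space k0 => z 0%N) nu mZ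
    (fun a => (val a)^*)).
  under eq_bigr do rewrite nu1 rmorph_sum mulr_sumr.
  by rewrite exchange_big pair_big; apply: eq_bigr => -[a b] _.
Qed.

Lemma pair_law_invariant (xi : probability (shift_space k0 * shift_space k0)%type R) :
  invariant_measure xi (@left_shift2 K K) ->
  stationary_law (coded_law (@pair_seq K k0) xi).
Proof. by apply: (coded_law_stationary coding_pair_seq). Qed.

Variables (mu nu : probability (shift_space k0) R) (x : nat -> K).
Hypothesis x_mu : generic x mu.

(** For the lift [y] of [x] along [xi] the prefix correlations converge, so their lower limit is the
    nonzero value given by [xi]. *)
Lemma joining_strongly_correlated xi : joining mu nu xi ->
  normc (pair_corr (fun a : K => val a)
    (fun c => coded_law (@pair_seq K k0) xi [:: c])) != 0 ->
  exists2 y, generic y nu &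
    strongly_correlated (fun i => val (x i)) (fun i => val (y i)).
Proof.
move=> xij xi0; have [xiS xi1 xi2] := xij.
set P := coded_law _ xi in xi0.
have Pl : stationary_law P by exact: pair_law_invariant.
have xP a : has_freq x a (fst_law P a).
  rewrite -fst_coded_law xi1; last exact: (measurable_cyl (coding_shift_space k0)).
  by apply/has_freqP; exact: (generic_freqP x mu).1.
have [y yP] := exists_lift k0 Pl xP.
have zP w : freq R (fun i => (x i, y i)) w @ \oo --> P w by exact/has_freqP.
exists y.
  apply/generic_freqP => w; rewrite /coded_law -xi2; last first.
    exact: (measurable_cyl (coding_shift_space k0)).
  rewrite snd_coded_law; have -> : freq R y w =
      (fun n => \sum_(a : (size w).-tuple K) freq R (fun i => (x i, y i)) (zip a w) n).
    by apply/funext => n; exact: freq_snd.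
  by apply: cvg_sum_fin => a; exact: zP.
rewrite /strongly_correlated.
under eq_fun do rewrite (prefix_corrE (fun a : K => val a)).
set r := normc _ in xi0.
have ur : (fun n => (normc (pair_corr (fun a : K => val a)
    (fun c => freq R (fun i => (x i, y i)) [:: c] n)))%:E) @ \oo --> r%:E.
  apply: cvg_EFin; first exact: nearW.
  by apply: pair_corr_cvg => c; exact: zP.
rewrite (cvg_limn_einf_sup ur).1 lte_fin lt_neqAle eq_sym xi0.
by rewrite /r; case: (pair_corr _ _) => a b; exact: sqrtr_ge0.
Qed.

Hypothesis K_disc : forall z : R[i], z \in K -> `|z| <= 1.

(** The limit law of the pair along a suitable ultrafilter has marginals [mu] and [nu]; realized as
    a measure, it is a joining with correlation at least [del]. *)
Lemma weakly_correlated_joining y : generic y nu ->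
  weakly_correlated (fun i => val (x i)) (fun i => val (y i)) -> correlated mu nu.
Proof.
move=> y_nu wxy; set v := fun a : K => val a.
pose z i := (x i, y i).
pose u n := normc (pair_corr v (fun c => freq R z [:: c] n)).
have {}wxy : (0 < limn_esup (fun n => (u n)%:E))%E.
  by move: wxy; rewrite /weakly_correlated; under eq_fun do rewrite (prefix_corrE v).
have [del del0 hdel] : exists2 del : R, 0 < del & (del%:E < limn_esup (fun n => (u n)%:E))%E.
  move: wxy; case: (limn_esup _) => [r|_|//].
    by rewrite lte_fin => r0; exists (r / 2); rewrite ?divr_gt0// lte_fin; lra.
  by exists 1 => //; exact: ltry.
pose D := [set n | del < u n].
(* If a set of the trace filter were empty, [u n <= del] would hold eventually and the upper limit
   could not exceed [del]. *)
have PF : ProperFilter (within D \oo).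
  apply: Build_ProperFilter_ex.
  move=> B DB; have := hdel; rewrite /limn_esup /limf_esup => hinf.
  have : (del%:E < ereal_sup [set (u n)%:E | n in [set n | D n -> B n]])%E.
    by apply: (lt_le_trans hinf); apply: ereal_inf_lbound; exists [set n | D n -> B n].
  by move=> /ereal_sup_gt[_ [n DBn <-]]; rewrite lte_fin => /DBn Bn; exists n.
have [G [GU DG]] := ultraFilterLemma PF.
have PG : ProperFilter G by exact: ultra_proper.
have GG : \oo `<=` G.
  by move=> B oB; apply: DG; apply: filterS oB.
have GD : G D by apply: DG; exact: withinT.
have [P [Pl zP]] := exists_limit_law R z GU GG.
pose dec (w : nat -> K * K) : shift_space k0 * shift_space k0 :=
  ((fun i => (w i).1) , (fun i => (w i).2)).
have decK w : pair_seq (dec w) = w.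
  by apply/funext => i; rewrite /pair_seq/=; case: (w i).
have [xi xiP] := exists_coded_law coding_pair_seq decK (k0, k0) Pl.
have xiPE : coded_law (@pair_seq K k0) xi = P by apply/funext.
have oo_cvg (f : nat -> R) l : f @ \oo --> l -> f @ G --> l.
  by move=> fl B /fl; exact: GG.
have mu1 w : fst_law P w = coded_law (fun x : shift_space k0 => x) mu w.
  apply: (@cvg_unique R^o (@Rhausdorff R) (freq R x w @ G)).
    have -> : freq R x w = (fun n => \sum_(b : (size w).-tuple K) freq R z (zip w b) n).
      by apply/funext => n; exact: freq_fst.
    by apply: cvg_sum_fin => b; exact: zP.
  by apply: oo_cvg; exact: (generic_freqP x mu).1.
have nu1 w : \sum_(a : (size w).-tuple K) P (zip a w) =
    coded_law (fun x : shift_space k0 => x) nu w.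
  apply: (@cvg_unique R^o (@Rhausdorff R) (freq R y w @ G)).
    have -> : freq R y w = (fun n => \sum_(a : (size w).-tuple K) freq R z (zip a w) n).
      by apply/funext => n; exact: freq_snd.
    by apply: cvg_sum_fin => b; exact: zP.
  by apply: oo_cvg; exact: (generic_freqP y nu).1.
pose f1 : {mfun (shift_space k0 * shift_space k0)%type >-> shift_space k0} :=
  HB.pack fst (isMeasurableFun.Build _ _ _ _ fst measurable_fst).
pose f2 : {mfun (shift_space k0 * shift_space k0)%type >-> shift_space k0} :=
  HB.pack snd (isMeasurableFun.Build _ _ _ _ snd measurable_snd).
have xij : joining mu nu xi.
  split.
  - by apply: (stationary_law_invariant coding_pair_seq) => //; rewrite xiPE.
  - move=> E mE; change (distribution xi f1 E = mu E).
    apply: (coding_unique (coding_shift_space k0)) mE => w.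
    by rewrite !(coded_lawE (coding_shift_space k0)) -mu1 -xiPE -fst_coded_law.
  - move=> E mE; change (distribution xi f2 E = nu E).
    apply: (coding_unique (coding_shift_space k0)) mE => w.
    by rewrite !(coded_lawE (coding_shift_space k0)) -nu1 -xiPE -snd_coded_law.
have rP : u @ G --> normc (pair_corr v (fun c => P [:: c])).
  by apply: pair_corr_cvg => c; exact: zP.
have r0 : del <= normc (pair_corr v (fun c => P [:: c])).
  apply: (@closed_cvg _ R^o G _ _ (fun t => del <= t)) rP; first exact: closed_ge.
  by apply: filterS GD => n /ltW.
rewrite /correlated gt_eqF//; apply: lt_le_trans del0 (le_trans r0 _).
(* The supremum dominates this value because the set is bounded above, by 2; this is where [K_disc]
   enters. *)
apply: ub_le_sup.
  exists 2 => _ [xi' xij' ->]; rewrite joining_corrE//.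
  have [iS _ _] := xij'; have [P0 Pge Pr _] := pair_law_invariant iS.
  apply: normc_pair_corr_le => //.
    by move=> a; apply: K_disc; exact: valP.
  by rewrite -[RHS]P0 Pr.
by exists xi => //; rewrite joining_corrE// xiPE.
Qed.

End measure_correlation.

Theorem theorem2p9 (R : realType) (K : {fset R[i]}) (k0 : K)
    (K_disc : forall z : R[i], z \in K -> `|z| <= 1)
    (mu : probability (shift_space k0) R)
    (mu_invariant : invariant_measure mu (@left_shift K))
    (x : nat -> K) (x_generic : generic x mu) :
  [<->
    exists y : nat -> K,
      (exists2 nu : probability (shift_space k0) R,
         ergodic nu (@left_shift K) & generic y nu) /\
      weakly_correlated (fun i => val (x i)) (fun i => val (y i));
    exists y : nat -> K,
      (exists2 nu : probability (shift_space k0) R,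
         ergodic nu (@left_shift K) & generic y nu) /\
      strongly_correlated (fun i => val (x i)) (fun i => val (y i));
    exists2 nu : probability (shift_space k0) R,
      ergodic nu (@left_shift K) & correlated mu nu].
Proof.
have strong_weak (y : nat -> K) :
    strongly_correlated (fun i => val (x i)) (fun i => val (y i)) ->
    weakly_correlated (fun i => val (x i)) (fun i => val (y i)).
  by move=> h; exact: lt_le_trans h (limn_einf_sup _).
have weak_measure : (exists y : nat -> K,
      (exists2 nu : probability (shift_space k0) R,
         ergodic nu (@left_shift K) & generic y nu) /\
      weakly_correlated (fun i => val (x i)) (fun i => val (y i))) ->
    exists2 nu : probability (shift_space k0) R,
      ergodic nu (@left_shift K) & correlated mu nu.
  move=> [y [[nu nu_erg y_nu] wxy]]; exists nu => //.
  exact: (weakly_correlated_joining x_generic K_disc y_nu wxy).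
have measure_strong : (exists2 nu : probability (shift_space k0) R,
      ergodic nu (@left_shift K) & correlated mu nu) ->
    exists y : nat -> K,
      (exists2 nu : probability (shift_space k0) R,
         ergodic nu (@left_shift K) & generic y nu) /\
      strongly_correlated (fun i => val (x i)) (fun i => val (y i)).
  move=> [nu nu_erg mu_nu].
  suff [xi xij xi0] : exists2 xi, joining mu nu xi &
      Normc.normc (pair_corr (fun a : K => val a)
        (fun c => coded_law (@pair_seq K k0) xi [:: c])) != 0.
    have [y y_nu sxy] := joining_strongly_correlated x_generic xij xi0.
    by exists y; split => //; exists nu.
  (* Otherwise the set of values is empty or reduced to 0; [sup] is 0 in both cases, by convention
     on the empty set. *)
  apply: contrapT => nex; move: mu_nu; rewrite /correlated /measure_corr => /eqP; apply.
  set E := [set r | _].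
  have E0 : E `<=` [set 0].
    move=> _ [xi xij ->]; rewrite joining_corrE//=.
    by apply: contrapT => /eqP xi0; apply: nex; exists xi.
  have [->|E1] := eqVneq E set0; first exact: sup0.
  have -> : E = [set 0]; last exact: sup1.
  apply/seteqP; split => // _ ->; have /set0P[r Er] := E1.
  by rewrite -(E0 r Er).
tfae.
- by move=> /weak_measure /measure_strong.
- by move=> [y [nu_y /strong_weak wxy]]; apply: weak_measure; exists y.
- by move=> /measure_strong[y [nu_y /strong_weak wxy]]; exists y.
Qed.
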